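(* Let $n=(n_1,n_2,\dots,n_t)$ be a $t$-tuple of positive integers and let $S(n)=n_1+\dots+n_t$. Suppose that the multinomial coefficient $$\binom{S(n)}{n_1,n_2,\dots,n_t}=\frac{S(n)!}{n_1!\,n_2!\cdots n_t!}$$ is odd. Then for every positive integer $d$, every $t$-tuple $v=(v_1,\dots,v_t)$ of directions in $\mathbb{R}^d$, and every $S(n)$ probability measures $\mu_1,\dots,\mu_{S(n)}$ on $\mathbb{R}^d$ that are absolutely continuous with respect to Lebesgue measure, there is an $(n,v)$-chessboard colouring $(A,B)$ of $\mathbb{R}^d$ such that $\mu_i(A)=\mu_i(B)=\tfrac12$ for all $i=1,\dots,S(n)$.
   Context: A direction in $\mathbb{R}^d$ is a nonzero vector. Given a $t$-tuple of positive integers $n=(n_1,\dots,n_t)$ and a $t$-tuple $v=(v_1,\dots,v_t)$ of directions in $\mathbb{R}^d$, a partition $(A,B)$ of $\mathbb{R}^d$ is an $(n,v)$-chessboard colouring if it can be obtained by taking, for each $i$, at most $n_i$ hyperplanes orthogonal to $v_i$, and using the resulting family of (full) hyperplanes to give a chessboard colouring of $\mathbb{R}^d$: each region of the arrangement is placed in $A$ or in $B$ so that any two regions that share a boundary of dimension $d-1$ are in different sets. (Points on the hyperplanes form a null set and are irrelevant.) *)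

(* Defs.v *)
From HB Require Import structures.
From mathcomp Require Import all_boot all_order all_algebra.
From mathcomp Require Import all_classical all_reals all_analysis.
From mathcomp Require Import measurable_realfun.
Set Implicit Arguments.
Unset Strict Implicit.
Unset Printing Implicit Defensive.
Import Order.TTheory GRing.Theory Num.Theory.
Import numFieldNormedType.Exports.
Local Open Scope classical_set_scope.
Local Open Scope ring_scope.

(* R^d with the sigma-algebra generated by its open sets *)
Notation borel_rV R d := (g_sigma_algebraType (@open 'rV[R]_d)).

Section Lebesgue.
Variable R : realType.

Lemma measurable_fun_rV d0 (T : measurableType d0) d (f : T -> borel_rV R d) :
  (forall j, measurable_fun [set: T]
     (fun t => (f t : 'rV[R]_d) ord0 j : measurableTypeR R)) ->
  measurable_fun [set: T] f.
Proof.
move=> mf.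
have H : @measurable _ (borel_rV R d) = <<s @open 'rV[R]_d >> by [].
apply: (@measurability _ _ _ (borel_rV R d) _ _ (@open 'rV[R]_d)) => // _ [U oU <-]; rewrite setTI.
pose box (w : 'rV[rat]_d * nat) : set 'rV[R]_d :=
  [set y | forall j, ball (ratr (w.1 ord0 j) : R) w.2.+1%:R^-1 (y ord0 j)].
have -> : f @^-1` U = \bigcup_(w in [set w | box w `<=` U]) (f @^-1` box w).
  apply/seteqP; split => [t Ut|t [w wU]]; last exact: wU.
  have /nbhs_ballP[e /= e0 eU] : nbhs (f t : 'rV[R]_d) U by exact: open_nbhs_nbhs.
  pose k := Num.trunc (2 / e).
  have ke : 2 * (k.+1%:R^-1 : R) < e.
    rewrite -ltr_pdivlMr ?invr_gt0// invrK -ltr_pdivrMl//.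
    by rewrite mulrC; exact: truncnS_gt.
  have k0 : (0 : R) < k.+1%:R^-1 by rewrite invr_gt0.
  have Q j : exists q : rat,
      ratr q \in `](f t : 'rV[R]_d) ord0 j - k.+1%:R^-1,
                  (f t : 'rV[R]_d) ord0 j + k.+1%:R^-1[.
    by apply: rat_in_itvoo; rewrite ltrD2l gtrN.
  have [q Hq] := choice Q.
  have dq j : `|ratr (q j) - (f t : 'rV[R]_d) ord0 j| < k.+1%:R^-1.
    by rewrite ltr_distl; have := Hq j; rewrite in_itv.
  exists (\row_j q j, k) => /= [y Hy|j]; last first.
    by rewrite mxE /ball /=; exact: dq.
  apply: eU; split=> // i j; rewrite ord1 /ball /=.
  have := Hy j; rewrite mxE /ball /= => Hyj.
  apply: le_lt_trans ke; rewrite mulr_natl mulr2n.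
  apply: (le_trans (ler_distD (ratr (q j)) _ _)).
  by apply: lerD; [rewrite distrC; apply/ltW/dq|exact/ltW].
rewrite bigcup_mkcond; apply: countable_bigcupT_measurable => // w.
case: ifPn => // _.
have -> : f @^-1` box w = \bigcap_(j in [set: 'I_d])
    ((fun t => (f t : 'rV[R]_d) ord0 j) @^-1`
       ball (ratr (w.1 ord0 j) : R) w.2.+1%:R^-1).
  by apply/seteqP; split=> [t H1 j _|t H1 j]; [exact: H1|exact: (H1 j)].
apply: fin_bigcap_measurable => [|j _]; first exact: finite_finset.
rewrite -[X in measurable X]setTI; apply: mf => //.
exact: measurable_ball.
Qed.

Lemma measurable_coord_rV d (j : 'I_d) :
  measurable_fun [set: borel_rV R d]
    (fun x : borel_rV R d => (x : 'rV[R]_d) ord0 j : measurableTypeR R).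
Proof.
apply: (measurability _ (RGenOInfty.measurableE R)) => _ [_ [a ->] <-].
rewrite setTI; apply: sub_sigma_algebra => /=.
by apply: open_comp; [move=> x _; exact: coord_continuous|exact: interval_open].
Qed.

Definition cons_rV d (p : measurableTypeR R * borel_rV R d) : borel_rV R d.+1 :=
  row_mx (p.1 : R)%:M (p.2 : 'rV[R]_d).

Definition uncons_rV d (x : borel_rV R d.+1) : measurableTypeR R * borel_rV R d :=
  ((x : 'rV[R]_d.+1) ord0 ord0, rsubmx (x : 'rV[R]_(1 + d))).

Lemma cons_rVE d (p : measurableTypeR R * borel_rV R d) (j : 'I_d.+1) :
  (cons_rV p : 'rV[R]_d.+1) ord0 j =
  if unlift ord0 j is Some k then (p.2 : 'rV[R]_d) ord0 k else p.1.
Proof.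
rewrite mxE; case: splitP => k jk; case: unliftP => [l|] jl.
- by move: jk; rewrite jl ord1.
- by rewrite mxE !ord1 eqxx.
- by have -> : k = l by apply/val_inj; move: jk; rewrite jl => -[].
- by move: jk; rewrite jl.
Qed.

Lemma cons_rVK d : cancel (@cons_rV d) (@uncons_rV d).
Proof.
move=> [a x]; rewrite /uncons_rV cons_rVE unlift_none; congr pair.
exact: row_mxKr.
Qed.

Lemma uncons_rVK d : cancel (@uncons_rV d) (@cons_rV d).
Proof.
move=> x; apply/rowP => j; rewrite cons_rVE.
case: unliftP => [k|] -> //=; rewrite mxE; congr (x _ _); exact/val_inj.
Qed.

Lemma measurable_cons_rV d : measurable_fun setT (@cons_rV d).
Proof.
apply: measurable_fun_rV => j; under eq_fun do rewrite cons_rVE.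
case: unliftP => [k _|_]; last exact: measurable_fst.
by apply: measurableT_comp (measurable_coord_rV k) _; exact: measurable_snd.
Qed.

Lemma measurable_uncons_rV d : measurable_fun setT (@uncons_rV d).
Proof.
apply/measurable_fun_pairP; split; first exact: measurable_coord_rV.
apply: measurable_fun_rV => j /=.
under eq_fun do rewrite mxE.
exact: measurable_coord_rV.
Qed.

Section step.
Variables (d : nat) (m : {sigma_finite_measure set (borel_rV R d) -> \bar R}).

Definition lebesgue_step : set (borel_rV R d.+1) -> \bar R :=
  pushforward (lebesgue_measure \x m)%E (@cons_rV d).

Let lebesgue_step0 : (lebesgue_step set0 = 0)%E.
Proof. by rewrite /lebesgue_step /pushforward preimage_set0 measure0. Qed.

Let lebesgue_step_ge0 A : (0 <= lebesgue_step A)%E.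
Proof. by rewrite /lebesgue_step /pushforward; exact: measure_ge0. Qed.

Let lebesgue_step_sigma_additive : semi_sigma_additive lebesgue_step.
Proof.
move=> F mF tF mUF; rewrite /lebesgue_step /pushforward preimage_bigcup.
apply: measure_sigma_additive => [n|].
  by rewrite -[X in measurable X]setTI; exact: measurable_cons_rV.
apply/trivIsetP => i j _ _ ij; rewrite -preimage_setI.
by move/trivIsetP : tF => -> //; rewrite preimage_set0.
Qed.

HB.instance Definition _ := isMeasure.Build _ _ _ lebesgue_step
  lebesgue_step0 lebesgue_step_ge0 lebesgue_step_sigma_additive.

Let lebesgue_step_sigma_finite : sigma_finite setT lebesgue_step.
Proof.
have /sigma_finiteP[F [TF ndF Foo]] := sigma_finiteT (@lebesgue_measure R).
have /sigma_finiteP[G [TG ndG Goo]] := sigma_finiteT m.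
exists (fun n => @uncons_rV d @^-1` (F n `*` G n)) => [|n].
  rewrite -preimage_bigcup (_ : \bigcup_n _ = setT) ?preimage_setT//.
  apply/seteqP; split => // -[x y] _.
  have [i _ Fi] : (\bigcup_i F i) x by rewrite -TF.
  have [j _ Gj] : (\bigcup_i G i) y by rewrite -TG.
  exists (maxn i j) => //; split => /=.
  - by move: x Fi; exact/subsetPset/ndF/leq_maxl.
  - by move: y Gj; exact/subsetPset/ndG/leq_maxr.
have [? ?] := Foo n; have [? ?] := Goo n; split.
  rewrite -[X in measurable X]setTI.
  by apply: measurable_uncons_rV => //; exact: measurableX.
rewrite /lebesgue_step /pushforward -comp_preimage.
rewrite (_ : _ \o _ = id); last by apply/funext => p; exact: cons_rVK.
by rewrite preimage_id product_measure1E// lte_mul_pinfty// ge0_fin_numE.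
Qed.

HB.instance Definition _ :=
  Measure_isSigmaFinite.Build _ _ _ lebesgue_step lebesgue_step_sigma_finite.

End step.

(* Lebesgue measure on the Borel sets of R^d, as the d-fold product of the
   one-dimensional one; [lebesgue_rV_box] below checks the normalisation. *)
Fixpoint lebesgue_rV d : {sigma_finite_measure set (borel_rV R d) -> \bar R} :=
  if d is d'.+1 then lebesgue_step (lebesgue_rV d')
  else \d_(0 : borel_rV R 0).


Lemma lebesgue_rV_box d (a b : 'rV[R]_d) :
  (forall j, a ord0 j <= b ord0 j) ->
  lebesgue_rV d
    [set x : 'rV[R]_d | forall j, x ord0 j \in `]a ord0 j, b ord0 j]] =
  (\prod_j (b ord0 j - a ord0 j))%:E.
Proof.
elim: d a b => [|d IH] a b ab.
  by rewrite big_ord0 /= diracE mem_set// => -[].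
rewrite /= /lebesgue_step /pushforward big_ord_recl EFinM.
pose tl (u : 'rV[R]_d.+1) : 'rV[R]_d := \row_j u ord0 (lift ord0 j).
have tlE u j : tl u ord0 j = u ord0 (lift ord0 j) by rewrite mxE.
set B := [set x : 'rV[R]_d |
  forall j, x ord0 j \in `](tl a) ord0 j, (tl b) ord0 j]].
rewrite (_ : _ @^-1` _ = `]a ord0 ord0, b ord0 ord0] `*` B); last first.
  apply/seteqP; split => -[r x] /=.
    move=> H; split=> [|j]; first by have := H ord0; rewrite cons_rVE unlift_none.
    by have := H (lift ord0 j); rewrite cons_rVE liftK !tlE.
  move=> [rab H] j; rewrite cons_rVE; case: unliftP => [k|] -> //=.
  by have := H k; rewrite !tlE.
rewrite product_measure1E//; last first.
  rewrite (_ : B = \bigcap_(j in [set: 'I_d])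
    ((fun x : 'rV[R]_d => x ord0 j) @^-1` `](tl a) ord0 j, (tl b) ord0 j])).
    apply: fin_bigcap_measurable => [|j _]; first exact: finite_finset.
    by rewrite -[X in measurable X]setTI; exact: measurable_coord_rV.
  by apply/seteqP; split=> [t H1 j _|t H1 j]; [exact: H1|exact: (H1 j)].
rewrite IH => [|j]; last by rewrite !tlE.
rewrite [X in (X * _)%E = _](lebesgue_measure_itv `]a ord0 ord0, b ord0 ord0]) /= lte_fin; congr (_ * _)%E.
  by case: ltgtP (ab ord0) => // <- _; rewrite subrr.
by congr EFin; apply: eq_bigr => j _; rewrite !tlE.
Qed.

End Lebesgue.

Section Chessboard.
Variables (R : realType) (d : nat).
Implicit Types (v x p : 'rV[R]_d) (c : R) (A B P Q S : set 'rV[R]_d).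

Definition hyperplane v c : set 'rV[R]_d :=
  [set x | \sum_j v ord0 j * x ord0 j = c].

(* [S] contains [k + 1] affinely independent points [p], [row 0 q], ... *)
Definition affine_dim_ge S (k : nat) : Prop :=
  exists (p : 'rV[R]_d) (q : 'M[R]_(k, d)),
    [/\ S p, forall i, S (row i q) & \rank (\matrix_i (row i q - p)) = k].

Definition affine_dim S (k : nat) : Prop :=
  affine_dim_ge S k /\ ~ affine_dim_ge S k.+1.

(* [C i] lists the offsets of the hyperplanes orthogonal to [v i]. *)
Definition arrangement t (v : 'I_t -> 'rV[R]_d) (C : 'I_t -> seq R) :
    set 'rV[R]_d :=
  \bigcup_(i in [set: 'I_t]) \bigcup_(c in [set` C i]) hyperplane (v i) c.

(* [H] is the union of the hyperplanes. *)
Definition region (H P : set 'rV[R]_d) : Prop :=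
  exists2 x, (~` H) x & P = connected_component (~` H) x.

Definition share_facet P Q : Prop :=
  P <> Q /\ affine_dim (closure P `&` closure Q) d.-1.

(* The points of [H] itself may be put in either class. *)
Definition chessboard_colouring_of (H A B : set 'rV[R]_d) : Prop :=
  [/\ A `|` B = setT, A `&` B = set0,
      forall P, region H P -> P `<=` A \/ P `<=` B &
      forall P Q, region H P -> region H Q -> share_facet P Q ->
        (P `<=` A /\ Q `<=` B) \/ (P `<=` B /\ Q `<=` A)].

Definition chessboard_colouring t (n : 'I_t -> nat) (v : 'I_t -> 'rV[R]_d)
    (A B : set 'rV[R]_d) : Prop :=
  exists C : 'I_t -> seq R,
    (forall i, (size (C i) <= n i)%N) /\
    chessboard_colouring_of (arrangement v C) A B.

End Chessboard.

(* Main.v *)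
(* A family of at most n_i hyperplanes orthogonal to v_i is the zero set of
   p_i(<v_i, x>) for a polynomial p_i of degree at most n_i, and the sign of the
   product of these over i is a chessboard colouring.  Replacing p_i by - p_i
   exchanges the colours, so the imbalances of the N = S(n) measures define a map
   from the product of the spheres S^(n_i) to R^N which is odd in each variable
   and, by absolute continuity, continuous.  It has a zero when the coefficient
   of x_1^(n_1) ... x_t^(n_t) in (x_1 + ... + x_t)^N is odd.

   This Borsuk-Ulam theorem is proved on the grid: S^n is the boundary of the
   integer cube [-2m, 2m]^(n+1), and s_k(e) is the sign of the k-th imbalance at
   the cell e.  The product z(n) of the upper hemispheres satisfies, modulo 2,
   d z(n) = sum_i (z(n - e_i) + g_i z(n - e_i)), with g_i the antipode in the i-th
   sphere.  As s_k (g_i e) = 1 + s_k e, the value on z(n) of the cup product of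
   the coboundaries of s_1, ..., s_N obeys the recursion of the multinomial
   coefficients.  When it is 1, some flag of faces has, for every k, two
   consecutive faces at which the k-th imbalance has opposite signs; as m tends to
   infinity such flags accumulate at a common zero of the imbalances. *)
Require Import Defs.
From mathcomp Require Import all_boot all_order all_algebra.
From mathcomp Require Import all_classical all_reals all_analysis.
From mathcomp Require Import zify lra ring measurable_realfun.
Set Implicit Arguments.
Unset Strict Implicit.
Unset Printing Implicit Defensive.
Import Order.TTheory GRing.Theory Num.Theory.
Import numFieldNormedType.Exports.

Notation "\xor_ ( x <- s ) F" := (\big[addb/false]_(x <- s) F)
  (at level 41, F at level 41, x, s at level 50, format "\xor_ ( x  <-  s )  F").

Lemma big_allpairs_cons (T : Type) (s1 : seq T) (s2 : seq (seq T))
    (phi : seq T -> bool) :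
  \xor_(y <- [seq x :: z | x <- s1, z <- s2]) phi y =
  \xor_(x <- s1) \xor_(z <- s2) phi (x :: z).
Proof. by rewrite big_allpairs_dep. Qed.

Fixpoint modify (T : Type) (f : T -> T) (i : nat) (s : seq T) : seq T :=
  if s is x :: s' then
    if i is j.+1 then x :: modify f j s' else f x :: s'
  else [::].

(** * Cubical chains modulo 2 and cup products *)

Section list_boundary.
Variables (T : Type) (bd : T -> seq T).

(* Faces of the product cell [s] when [bd x] lists the faces of the cell [x];
   all chains have coefficients modulo 2. *)
Fixpoint lbd (s : seq T) : seq (seq T) :=
  if s is x :: s' then
    [seq y :: s' | y <- bd x] ++ [seq x :: z | z <- lbd s']
  else [::].

Lemma xor_lbd_cons x s (phi : seq T -> bool) :
  \xor_(y <- lbd (x :: s)) phi y =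
  \xor_(y <- bd x) phi (y :: s) (+) \xor_(z <- lbd s) phi (x :: z).
Proof. by rewrite /= big_cat !big_map. Qed.

Lemma lbd_even : (forall x, \xor_(y <- bd x) true = false) ->
  forall s, \xor_(y <- lbd s) true = false.
Proof.
move=> bd_even; elim=> [|x s IH]; first by rewrite big_nil.
by rewrite xor_lbd_cons bd_even IH.
Qed.

(** One face in the head and one in the tail can be taken in either order; the two sums agree after
    [exchange_big] and cancel modulo 2. *)
Lemma lbdK : (forall x phi, \xor_(y <- bd x) \xor_(z <- bd y) phi z = false) ->
  forall s phi, \xor_(y <- lbd s) \xor_(z <- lbd y) phi z = false.
Proof.
move=> bdK; elim=> [|x s IH] phi; first by rewrite big_nil.
rewrite xor_lbd_cons.
under eq_bigr do rewrite xor_lbd_cons.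
under [X in _ (+) X]eq_bigr do rewrite xor_lbd_cons.
rewrite !big_split /= IH (bdK _ (fun z => phi (z :: s))) addbF addFb.
by rewrite exchange_big addbb.
Qed.

Lemma xor_lbd_modify (f : T -> T) :
  (forall x phi, \xor_(y <- bd (f x)) phi y = \xor_(y <- bd x) phi (f y)) ->
  forall i s phi,
  \xor_(y <- lbd (modify f i s)) phi y = \xor_(y <- lbd s) phi (modify f i y).
Proof.
move=> bdf i s; elim: s i => [|x s IH] [|i] phi; rewrite ?big_nil//=.
  by rewrite !big_cat !big_map /= bdf.
by rewrite !big_cat !big_map /= IH.
Qed.

Lemma xor_lbd_map (f : T -> T) :
  (forall x phi, \xor_(y <- bd (f x)) phi y = \xor_(y <- bd x) phi (f y)) ->
  forall s phi,
  \xor_(y <- lbd (map f s)) phi y = \xor_(y <- lbd s) phi (map f y).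
Proof.
move=> bdf; elim=> [|x s IH] phi; first by rewrite !big_nil.
by rewrite !xor_lbd_cons bdf IH.
Qed.

End list_boundary.

(** * The integer cube, its boundary sphere and its hemispheres *)

Section hemisphere.
Local Open Scope ring_scope.

(* Cubical cells of the integer lattice: an odd coordinate [x] stands for the
   interval [x - 1, x + 1], an even one for a point. *)
Definition ibd (x : int) : seq int :=
  if odd `|x| then [:: x + 1; x - 1] else [::].

Lemma ibd_even x : \xor_(y <- ibd x) true = false.
Proof. by rewrite /ibd; case: odd; rewrite ?big_cons big_nil. Qed.

Lemma ibdK x phi : \xor_(y <- ibd x) \xor_(z <- ibd y) phi z = false.
Proof.
rewrite {1}/ibd; case: ifP => [ox|_]; last by rewrite big_nil.
by rewrite !big_cons big_nil /ibd !ifF ?big_nil//; lia.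
Qed.

Lemma xor_ibdN x phi : \xor_(y <- ibd (- x)) phi y = \xor_(y <- ibd x) phi (- y).
Proof.
rewrite /ibd abszN; case: odd; last by rewrite !big_nil.
rewrite !big_cons !big_nil !addbF addbC.
by congr addb; congr phi; lia.
Qed.

Variable m : nat.

Definition half_interval : seq int := [seq j.*2.+1%:Z | j <- iota 0 m].

Fixpoint cube (n : nat) : seq (seq int) :=
  if n is n'.+1 then
    [seq x :: b | x <- half_interval ++ map -%R half_interval, b <- cube n']
  else [:: [::]].

(** The boundary of the cube, by the Leibniz rule. The indices are shifted: [sphere n] has dimension
    n - 1 and [sphere 0] is empty, whereas [hemisphere n] has dimension n. *)
Fixpoint sphere (n : nat) : seq (seq int) :=
  if n is n'.+1 then
    [seq x :: b | x <- [:: m.*2%:Z; - m.*2%:Z], b <- cube n'] ++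
    [seq x :: b | x <- half_interval ++ map -%R half_interval, b <- sphere n']
  else [::].

Definition hemisphere (n : nat) : seq (seq int) :=
  [seq m.*2%:Z :: b | b <- cube n] ++
  [seq x :: b | x <- half_interval, b <- sphere n].

Lemma xor_half_interval phi :
  \xor_(x <- half_interval) \xor_(y <- ibd x) phi y = phi m.*2%:Z (+) phi 0.
Proof.
rewrite /half_interval big_map; elim: {1 2}m => [|k IH].
  by rewrite big_nil addbb.
rewrite -addn1 iotaD big_cat big_seq1 /= IH add0n addn1 /ibd.
rewrite (_ : odd _ = true); last by lia.
rewrite !big_cons big_nil addbF.
have -> : k.*2.+1%:Z + 1 = k.+1.*2%:Z by lia.
have -> : k.*2.+1%:Z - 1 = k.*2%:Z by lia.
by case: (phi k.*2%:Z); case: (phi 0); case: (phi _).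
Qed.

Lemma xor_interval phi :
  \xor_(x <- half_interval ++ map -%R half_interval) \xor_(y <- ibd x) phi y =
  phi m.*2%:Z (+) phi (- m.*2%:Z).
Proof.
rewrite big_cat /= xor_half_interval big_map.
under [X in _ (+) X]eq_bigr do rewrite xor_ibdN.
rewrite (xor_half_interval (phi \o -%R)) /= oppr0.
by rewrite addbACA addbb addbF.
Qed.

Lemma xor_cubeS n (phi : seq int -> bool) :
  \xor_(b <- cube n.+1) phi b =
  \xor_(x <- half_interval ++ map -%R half_interval) \xor_(b <- cube n) phi (x :: b).
Proof. exact: big_allpairs_cons. Qed.

Lemma xor_cubeN n (phi : seq int -> bool) :
  \xor_(b <- cube n) phi (map -%R b) = \xor_(b <- cube n) phi b.
Proof.
elim: n phi => [|n IH] phi; first by rewrite !big_seq1.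
rewrite !xor_cubeS !big_cat /= !(big_map -%R) /= addbC.
congr addb; apply: eq_bigr => x _.
- by rewrite opprK (IH (fun b => phi (x :: b))).
- by rewrite (IH (fun b => phi (- x :: b))).
Qed.

Lemma xor_sphere n (phi : seq int -> bool) :
  \xor_(b <- sphere n) phi b = \xor_(b <- cube n) \xor_(y <- lbd ibd b) phi y.
Proof.
elim: n phi => [|n IH] phi; first by rewrite big_nil big_seq1 big_nil.
rewrite big_cat xor_cubeS !big_allpairs_cons.
under [RHS]eq_bigr do under eq_bigr do rewrite xor_lbd_cons.
under [RHS]eq_bigr do rewrite big_split.
rewrite [RHS]big_split !big_cons big_nil addbF /=; congr addb.
  rewrite exchange_big /= -big_split; apply: eq_bigr => b _ /=.
  by rewrite (xor_interval (fun z => phi (z :: b))).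
by apply: eq_bigr => x _; rewrite (IH (fun b => phi (x :: b))).
Qed.

Lemma xor_sphereN n (phi : seq int -> bool) :
  \xor_(b <- sphere n) phi (map -%R b) = \xor_(b <- sphere n) phi b.
Proof.
rewrite !xor_sphere -[RHS]xor_cubeN; apply: eq_bigr => b _.
by rewrite (xor_lbd_map xor_ibdN).
Qed.

Lemma xor_hemisphere n (phi : seq int -> bool) :
  \xor_(b <- hemisphere n) phi b =
  \xor_(b <- cube n) phi (m.*2%:Z :: b) (+)
  \xor_(x <- half_interval) \xor_(b <- sphere n) phi (x :: b).
Proof. by rewrite big_cat big_map /= big_allpairs_cons. Qed.

(** The full antipode can replace the reflection of the first coordinate because the cube and sphere
    factors are invariant under negation as chains modulo 2. *)
Lemma sphereS_hemisphere n (phi : seq int -> bool) :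
  \xor_(b <- sphere n.+1) phi b =
  \xor_(b <- hemisphere n) (phi b (+) phi (map -%R b)).
Proof.
rewrite big_cat !big_allpairs_cons /= !big_cons big_nil addbF.
rewrite xor_hemisphere !big_split /=.
rewrite (xor_cubeN n (fun b => phi (- m.*2%:Z :: b))).
congr addb; rewrite big_cat /= (big_map -%R) /= -big_split /=.
apply: eq_bigr => x _; rewrite big_split /=; congr addb.
by rewrite (xor_sphereN n (fun b => phi (- x :: b))).
Qed.

(** The boundary of the top face cancels the outer ends of the half-intervals, and the sphere factor
    is a cycle; only the equator, at first coordinate 0, remains. *)
Lemma hemisphere_boundary n (phi : seq int -> bool) :
  \xor_(b <- hemisphere n) \xor_(y <- lbd ibd b) phi y =
  \xor_(b <- sphere n) phi (0 :: b).
Proof.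
rewrite xor_hemisphere.
have ibdM : ibd m.*2%:Z = [::] by rewrite /ibd ifF//; lia.
under eq_bigr do rewrite xor_lbd_cons ibdM big_nil addFb.
under [X in _ (+) X]eq_bigr do under eq_bigr do rewrite xor_lbd_cons.
under [X in _ (+) X]eq_bigr do rewrite big_split.
rewrite [X in _ (+) X]big_split /=.
rewrite [X in _ (+) (X (+) _)]exchange_big /=.
under [X in _ (+) (X (+) _)]eq_bigr do
  rewrite (xor_half_interval (fun z => phi (z :: _))).
rewrite [in X in _ (+) (X (+) _)]big_split /=.
rewrite -(xor_sphere n (fun z => phi (_ :: z))) -addbA addbA addbb addFb.
rewrite [X in _ (+) X]big1 ?addbF//.
move=> x _; rewrite xor_sphere; rewrite big1// => b _.
exact: (lbdK ibdK b (fun z => phi (x :: z))).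
Qed.

Variable L : nat.

(* Left padding puts all block cells in dimension [L], where the sphere of
   dimension [n - 1] is the equator of that of dimension [n]. *)
Definition hemi (n : nat) : seq (seq int) :=
  [seq nseq (L - n.+1) 0 ++ b | b <- hemisphere n].

Lemma xor_lbd_pad k b (phi : seq int -> bool) :
  \xor_(y <- lbd ibd (nseq k 0 ++ b)) phi y =
  \xor_(y <- lbd ibd b) phi (nseq k 0 ++ y).
Proof.
elim: k phi => //= k IH phi.
by rewrite big_map (IH (fun y => phi (0 :: y))).
Qed.

Lemma hemi_boundary0 (phi : seq int -> bool) :
  \xor_(b <- hemi 0) \xor_(y <- lbd ibd b) phi y = false.
Proof.
rewrite big_map.
under eq_bigr do rewrite xor_lbd_pad.
rewrite (hemisphere_boundary 0 (fun y => phi (nseq (L - 1) 0 ++ y))).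
by rewrite big_nil.
Qed.

(** The equator is the union of two hemispheres of one dimension less, and its coordinate 0 becomes
    one more padding zero. The bound on n keeps [L - n.+2] from truncating. *)
Lemma hemi_boundaryS n (phi : seq int -> bool) : (n.+1 < L)%N ->
  \xor_(b <- hemi n.+1) \xor_(y <- lbd ibd b) phi y =
  \xor_(b <- hemi n) (phi b (+) phi (map -%R b)).
Proof.
move=> nL; rewrite !big_map.
under eq_bigr do rewrite xor_lbd_pad.
rewrite (hemisphere_boundary n.+1 (fun y => phi (nseq _ 0 ++ y))).
rewrite sphereS_hemisphere; apply: eq_bigr => b _.
have e c : nseq (L - n.+2) (0 : int) ++ 0 :: c = nseq (L - n.+1) 0 ++ c.
  rewrite -cat_rcons; congr cat.
  have -> : (L - n.+1 = (L - n.+2).+1)%N by lia.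
  by elim: (L - n.+2)%N => //= k ->.
by rewrite !e map_cat map_nseq oppr0.
Qed.

End hemisphere.

(* Meaningful when [k = sumn ns]; this is the recursion that [chain_boundary]
   induces on the values of [cup]. *)
Fixpoint multinomial (k : nat) (ns : seq nat) : nat :=
  if k is k'.+1 then
    \sum_(i < size ns | 0 < nth 0 ns i) multinomial k' (modify predn i ns)
  else 1.

Lemma size_modify (T : Type) (f : T -> T) i s : size (modify f i s) = size s.
Proof. by elim: s i => [|x s IH] [|i] //=; rewrite IH. Qed.

Lemma nth_modify (T : Type) (f : T -> T) i s x0 j : j < size s ->
  nth x0 (modify f i s) j = if j == i then f (nth x0 s j) else nth x0 s j.
Proof.
elim: s i j => [|x s IH] [|i] [|j] //=; rewrite ltnS => js.
by rewrite IH// eqSS.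
Qed.

Lemma sumn_modify_pred i ns : 0 < nth 0 ns i ->
  (sumn (modify predn i ns)).+1 = sumn ns.
Proof.
elim: ns i => [|x s IH] [|i] //=; first by case: x.
by move=> si; rewrite -addnS IH.
Qed.

Lemma prod_fact_modify_pred i ns : 0 < nth 0 ns i ->
  \prod_(x <- ns) x`! = nth 0 ns i * \prod_(x <- modify predn i ns) x`!.
Proof.
elim: ns i => [|x s IH] [|i] //=.
  by case: x => // x _; rewrite !big_cons factS mulnA.
by move=> si; rewrite !big_cons (IH i si) mulnCA.
Qed.

(** Extracting n_i from n_i! turns the i-th summand into n_i times (k - 1)!, and the n_i add up to
    k. *)
Lemma multinomial_fact ns :
  multinomial (sumn ns) ns * \prod_(x <- ns) x`! = (sumn ns)`!.
Proof.
move E: (sumn ns) => k; elim: k ns E => [|k IH] ns nsk.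
  rewrite mul1n big1_seq// => x /= xs.
  suff -> : x = 0 by [].
  elim: ns nsk xs => //= y s IH /eqP; rewrite addn_eq0 inE.
  by move=> /andP[/eqP -> /eqP s0] /predU1P[//|]; apply: IH.
rewrite /= big_distrl /= factS -nsk sumnE.
rewrite [in RHS](big_nth 0) [in RHS]big_mkord [in RHS]big_distrl /=.
rewrite [RHS](bigID (fun i : 'I__ => 0 < nth 0 ns i)) /=.
rewrite [X in _ = _ + X]big1 ?addn0 => [|i]; last by rewrite -eqn0Ngt => /eqP ->.
apply: eq_bigr => i si.
rewrite (prod_fact_modify_pred si) mulnCA -(IH (modify predn i ns))//.
by apply: succn_inj; rewrite (sumn_modify_pred si).
Qed.

(** * Products of hemispheres and the discrete Borsuk-Ulam theorem *)

Section product_chain.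
Variables m L : nat.

Notation cell := (seq (seq int)).
Notation cbd := (lbd (lbd ibd)).
Notation hemi := (hemi m L).

Fixpoint chain (ns : seq nat) : seq cell :=
  if ns is n :: ns' then [seq b :: e | b <- hemi n, e <- chain ns'] else [:: [::]].

Definition antipode (i : nat) (e : cell) : cell :=
  modify (map (@GRing.opp int)) i e.

Lemma xor_cbd_antipode i e (phi : cell -> bool) :
  \xor_(y <- cbd (antipode i e)) phi y = \xor_(y <- cbd e) phi (antipode i y).
Proof. by apply: xor_lbd_modify => b psi; apply: xor_lbd_map => x; exact: xor_ibdN. Qed.

Lemma cbdK e phi : \xor_(y <- cbd e) \xor_(z <- cbd y) phi z = false.
Proof. exact/lbdK/lbdK/ibdK. Qed.

Lemma cbd_even e : \xor_(y <- cbd e) true = false.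
Proof. exact/lbd_even/lbd_even/ibd_even. Qed.

Lemma xor_chain_cons n ns (phi : cell -> bool) :
  \xor_(e <- chain (n :: ns)) phi e =
  \xor_(b <- hemi n) \xor_(e <- chain ns) phi (b :: e).
Proof. exact: big_allpairs_cons. Qed.

(** Leibniz rule over the blocks, with [hemi_boundaryS] in each one. Blocks of dimension 0 have no
    boundary, hence the filter on the sum. *)
Lemma chain_boundary ns (phi : cell -> bool) : all (fun n => n < L) ns ->
  \xor_(e <- chain ns) \xor_(y <- cbd e) phi y =
  \big[addb/false]_(i < size ns | 0 < nth 0 ns i)
    \xor_(e <- chain (modify predn i ns)) (phi e (+) phi (antipode i e)).
Proof.
elim: ns phi => [|n ns IH] phi; first by rewrite big_seq1 big_nil big_ord0.
move=> /andP[nL nsL]; rewrite xor_chain_cons [RHS]big_mkcond [RHS]big_ord_recl /=.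
under eq_bigr do under eq_bigr do rewrite xor_lbd_cons.
under eq_bigr do rewrite big_split.
rewrite big_split /=; congr addb.
  rewrite exchange_big /=.
  have [n0|n0] := posnP n.
    rewrite big1//= => e _.
    by rewrite n0 (hemi_boundary0 m L (fun b => phi (b :: e))).
  case: n n0 nL => // n _ nL.
  rewrite xor_chain_cons [RHS]exchange_big /=; apply: eq_bigr => e _.
  by rewrite (hemi_boundaryS m (fun b => phi (b :: e)) nL).
under eq_bigr do rewrite (IH (fun e => phi (_ :: e)) nsL) big_mkcond.
rewrite exchange_big /=; apply: eq_bigr => i _.
case: ifP => ni; first by rewrite xor_chain_cons.
by rewrite big1_eq.
Qed.

Section cup.
Variable s : nat -> cell -> bool.

(* The cup product of the coboundaries of the 0-cochains [s k.-1], ..., [s 0],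
   evaluated on the flags of faces of the cell [e]. *)
Fixpoint cup (k : nat) (e : cell) : bool :=
  if k is k'.+1 then \xor_(y <- cbd e) (s k' y && cup k' y) else true.

(** For k = 0 a cell has an even number of faces; for positive k the cochain is itself a
    coboundary. *)
Lemma cup_cocycle k e : \xor_(y <- cbd e) cup k y = false.
Proof. by case: k => [|k] /=; [exact: cbd_even|exact: cbdK]. Qed.

(** The term [s k e] may be added because [cup s k] is a cocycle; the first factor then detects a
    change of [s k] between e and its face y. *)
Lemma cup_coboundary k e :
  cup k.+1 e = \xor_(y <- cbd e) ((s k e (+) s k y) && cup k y).
Proof.
under [RHS]eq_bigr do rewrite andb_addl.
rewrite big_split /= -[X in _ = X (+) _]big_distrr /= cup_cocycle andbF.
by rewrite addFb.
Qed.

End cup.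

(* Being even, a coordinate [m.*2] or [- m.*2] survives in all faces. *)
Definition nondegenerate (e : cell) : bool :=
  all (has (fun x : int => `|x|%N == m.*2)) e.

Lemma nondegenerate_cbd e y : nondegenerate e -> y \in cbd e -> nondegenerate y.
Proof.
elim: e y => //= b e IH y /andP[bm em]; rewrite mem_cat.
case/orP => /mapP[c cP ->] /=; last by rewrite bm (IH c).
rewrite [X in _ && X]em andbT; elim: b c bm cP => //= x b IHb c xb.
rewrite mem_cat => /orP[] /mapP[z zP ->] /=.
  case/orP: xb => [xm|->]; last exact: orbT.
  by move: zP; rewrite /ibd ifF//; lia.
by case/orP: xb => [->//|bm]; rewrite (IHb z) ?orbT.
Qed.

Lemma size_lbd (T : eqType) (bd : T -> seq T) s y : y \in lbd bd s -> size y = size s.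
Proof.
elim: s y => //= x s IH y; rewrite mem_cat => /orP[] /mapP[z zP ->] //=.
by rewrite IH.
Qed.

Lemma size_cube n b : b \in cube m n -> size b = n.
Proof.
elim: n b => [|n IH] b /=; first by rewrite inE => /eqP ->.
by move=> /allpairsP[[x d] /= [_ dP ->]] /=; rewrite IH.
Qed.

Lemma size_sphere n b : b \in sphere m n -> size b = n.
Proof.
elim: n b => // n IH b; rewrite /sphere -/sphere mem_cat.
case/orP => /allpairsP[[x d] /= [_ dP ->]] /=; last by rewrite IH.
by rewrite (size_cube dP).
Qed.

Lemma sphere_face n b : b \in sphere m n -> has (fun x : int => `|x|%N == m.*2) b.
Proof.
elim: n b => // n IH b; rewrite /sphere -/sphere mem_cat.
case/orP => /allpairsP[[x d] /= [xP dP ->]] /=; last by rewrite IH ?orbT.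
by move: xP; rewrite !inE; case/orP => /eqP ->; rewrite ?abszN eqxx.
Qed.

Lemma half_interval_bound x : x \in half_interval m -> `|x|%N <= m.*2.
Proof. by case/mapP => k; rewrite mem_iota => /andP[_ km] ->; lia. Qed.

Lemma interval_bound x :
  x \in half_interval m ++ map (@GRing.opp int) (half_interval m) -> `|x|%N <= m.*2.
Proof.
rewrite mem_cat => /orP[/half_interval_bound//|/mapP[y /half_interval_bound ym ->]].
by rewrite abszN.
Qed.

Lemma cube_bound n b : b \in cube m n -> all (fun x : int => `|x|%N <= m.*2) b.
Proof.
elim: n b => [|n IH] b /=; first by rewrite inE => /eqP ->.
by move=> /allpairsP[[x d] /= [/interval_bound xm dP ->]] /=; rewrite xm IH.
Qed.

Lemma sphere_bound n b : b \in sphere m n -> all (fun x : int => `|x|%N <= m.*2) b.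
Proof.
elim: n b => // n IH b; rewrite /sphere -/sphere mem_cat.
case/orP => /allpairsP[[x d] /= [xP dP ->]] /=.
  rewrite (cube_bound dP) andbT.
  by move: xP; rewrite !inE; case/orP => /eqP ->; lia.
by rewrite (interval_bound xP) IH.
Qed.

Lemma hemi_cell n b : n < L -> b \in hemi n ->
  [/\ size b = L, has (fun x : int => `|x|%N == m.*2) b,
      all (fun x : int => `|x|%N <= m.*2) b &
      forall j, j < L - n.+1 -> nth 0%R b j = 0%R].
Proof.
move=> nL /mapP[c cP ->].
suff [cn cm cb] : [/\ size c = n.+1, has (fun x : int => `|x|%N == m.*2) c &
    all (fun x : int => `|x|%N <= m.*2) c].
  split; first by rewrite size_cat size_nseq cn; lia.
  - by rewrite has_cat cm orbT.
  - by rewrite all_cat cb all_nseq orbT.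
  - by move=> j jL; rewrite nth_cat size_nseq jL nth_nseq jL.
move: cP; rewrite mem_cat => /orP[/mapP[d dP ->]|/allpairsP[[x d] /= [xP dP ->]]] /=.
  by rewrite (size_cube dP) eqxx (cube_bound dP); split=> //; lia.
by rewrite (size_sphere dP) (sphere_face dP) orbT (sphere_bound dP) half_interval_bound.
Qed.

(** As m tends to infinity, the bound gives compactness, nondegeneracy keeps every block nonzero,
    and the leading zeros bound the degree of the i-th polynomial by n_i. *)
Lemma chain_cell ns e : all (fun n => n < L) ns -> e \in chain ns ->
  [/\ size e = size ns, nondegenerate e &
      forall i, i < size ns -> [/\ size (nth [::] e i) = L,
        all (fun x : int => `|x|%N <= m.*2) (nth [::] e i) &
        forall j, j < L - (nth 0 ns i).+1 -> nth 0%R (nth [::] e i) j = 0%R]].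
Proof.
elim: ns e => [|n ns IH] e; first by rewrite inE => _ /eqP ->.
move=> /andP[nL nsL] /allpairsP[[b d] /= [bP dP ->]].
have [dn dg dz] := IH _ nsL dP.
have [bL bm bb bz] := hemi_cell nL bP.
split; rewrite /= ?dn ?bm//.
by case=> [|i] //=; rewrite ltnS; exact: dz.
Qed.

Variables (t : nat) (s : nat -> cell -> bool).

Definition odd_cochain (u : cell -> bool) : Prop :=
  forall i e, i < t -> size e = t -> nondegenerate e ->
    u (antipode i e) = ~~ u e.

Hypothesis s_odd : forall k, odd_cochain (s k).

(** Negating the outermost cochain adds a sum of lower cup products over the faces of e, which is
    zero by [cup_cocycle]. *)
Lemma cup_antipode k i e : i < t -> size e = t -> nondegenerate e ->
  cup s k (antipode i e) = cup s k e.
Proof.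
move=> it; elim: k e => // k IH e et en /=; rewrite xor_cbd_antipode.
transitivity (\xor_(y <- cbd e) (cup s k y (+) (s k y && cup s k y))).
  apply: eq_big_seq => y ye.
  have yt : size y = t by rewrite (size_lbd ye).
  have yn := nondegenerate_cbd en ye.
  by rewrite IH// s_odd//; case: (s k y); case: cup.
by rewrite big_split /= cup_cocycle.
Qed.

(** The coboundary is moved onto the chain, where [chain_boundary] applies. On e and its antipode
    [s k] takes opposite values and [cup s k] equal ones, so the pair contributes [cup s k e]: this
    is the recursion of [multinomial]. *)
Lemma cup_chain ns k : size ns = t -> all (fun n => n < L) ns -> sumn ns = k ->
  \xor_(e <- chain ns) cup s k e = odd (multinomial k ns).
Proof.
move=> + + E; elim: k ns E => [|k IH] ns nsk nst nsL.
  transitivity (\xor_(e <- chain ns) true) => //.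
  elim: ns nsk {nst nsL} => [|n ns IH]; first by rewrite big_seq1.
  move/eqP; rewrite addn_eq0 => /andP[/eqP -> /eqP/IH].
  rewrite xor_chain_cons big_map => ->.
  rewrite (xor_hemisphere m 0 (fun _ => true)) big_seq1 big1//.
  by move=> x _; rewrite big_nil.
rewrite [LHS](chain_boundary (fun y => s k y && cup s k y) nsL) /=.
rewrite (big_morph _ oddD (erefl (odd 0))); apply: eq_bigr => i ni.
set ns' := modify predn i ns.
have ns't : size ns' = t by rewrite size_modify.
have ns'L : all (fun n => n < L) ns'.
  apply/(all_nthP 0) => j; rewrite size_modify => jns.
  rewrite nth_modify//; move/all_nthP : nsL => /(_ 0 j jns).
  by case: ifP => // _; apply: leq_ltn_trans; exact: leq_pred.
rewrite -IH//; last by apply: succn_inj; rewrite sumn_modify_pred.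
apply: eq_big_seq => e eP.
have [et en _] := chain_cell ns'L eP.
have it : i < t by rewrite -nst.
rewrite cup_antipode ?et// s_odd ?et//.
by case: (s k e); case: cup.
Qed.

Definition near_cell (r : nat) (e u : cell) : Prop :=
  forall i j, (`|nth 0 (nth [::] e i) j - nth 0 (nth [::] u i) j|%R <= r%:Z)%R.

Lemma near_cbd e y : y \in cbd e -> near_cell 1 e y.
Proof.
elim: e y => //= b e IH y; rewrite mem_cat.
case/orP => /mapP[c cP ->] [|i] j /=; rewrite ?subrr ?normr0//; last exact: IH.
elim: b c j cP => //= x b IHb c j; rewrite mem_cat.
case/orP => /mapP[d dP ->]; case: j => [|j] /=; rewrite ?subrr ?normr0//;
  last exact: IHb.
by move: dP; rewrite /ibd; case: ifP => // _; rewrite !inE => /orP[] /eqP ->; lia.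
Qed.

(** A nonzero sum modulo 2 has a nonzero term: at some face y of e the top cochain has changed and
    the lower cup product is still true. Descending from y finds the remaining changes, each step
    moving by at most 1. *)
Lemma cup_flag k e : size e = t -> nondegenerate e -> cup s k e ->
  forall j, j < k -> exists u w,
    [/\ near_cell k e u, near_cell k e w, size u = t, nondegenerate u &
        [/\ size w = t, nondegenerate w & s j u != s j w]].
Proof.
elim: k e => // k IH e et en; rewrite cup_coboundary => ck j.
have [y ye /andP[ky cy]] : exists2 y, y \in cbd e & (s k e (+) s k y) && cup s k y.
  apply/hasP; apply: contraT => /hasPn no; move: ck.
  by rewrite big1_seq// => y /= /no/negbTE.
have yt : size y = t by rewrite (size_lbd ye).
have yn := nondegenerate_cbd en ye.
have ey := near_cbd ye.
rewrite ltnS leq_eqVlt => /predU1P[->|jk].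
  exists e, y; split=> //.
  - by move=> a b; rewrite subrr normr0.
  - by move=> a b; apply: le_trans (ey a b) _; lia.
  - by split=> //; move: ky; case: (s k e); case: (s k y).
have [u [w [yu yw ut un [wt wn sj]]]] := IH y yt yn cy j jk.
exists u, w; split=> //.
- by move=> a b; have := ey a b; have := yu a b; lia.
- by move=> a b; have := ey a b; have := yw a b; lia.
Qed.

(** Discrete Borsuk-Ulam theorem. The distance from e to the sign changes is bounded independently
    of m, so it vanishes after rescaling. *)
Theorem odd_sign_changes ns : size ns = t -> all (fun n => n < L) ns ->
  odd (multinomial (sumn ns) ns) ->
  exists2 e, e \in chain ns & forall j, j < sumn ns -> exists u w,
    [/\ near_cell (sumn ns) e u, near_cell (sumn ns) e w,
        size u = t, nondegenerate u &
        [/\ size w = t, nondegenerate w & s j u != s j w]].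
Proof.
move=> nst nsL; rewrite -(cup_chain nst nsL (erefl _)) => co.
have [e eP ce] : exists2 e, e \in chain ns & cup s (sumn ns) e.
  apply/hasP; apply: contraT => /hasPn no; move: co.
  by rewrite big1_seq// => y /= /no/negbTE.
have [et en _] := chain_cell nsL eP.
by exists e => //; apply: cup_flag; rewrite ?et.
Qed.

End product_chain.


(** * Measures of sign sets *)

Local Open Scope classical_set_scope.
Local Open Scope ring_scope.

(** The cube is compact, so the sequence has a cluster point; [f k] is an index past k whose term is
    within 1/(k + 1) of it. Such an [f] need not be increasing, but it tends to infinity. *)
Lemma bounded_seq_extraction (R : realType) (I : finType) (x : nat -> I -> R) :
  (forall k i, `|x k i| <= 1) ->
  exists (f : nat -> nat) (a : I -> R), (forall k, (k <= f k)%N) /\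
    forall i, (fun k => x (f k) i) @ \oo --> a i.
Proof.
move=> x1.
pose y k : 'rV[R]_#|I| := \row_j x k (enum_val j).
have cK : compact [set v : 'rV[R]_#|I| | forall j, v ord0 j \in `[(-1 : R), 1]].
  apply: (@rV_compact _ _ (fun=> `[(-1 : R), 1]%classic)) => j.
  exact: segment_compact.
have [a [_ /= ca]] : [set v : 'rV[R]_#|I| | forall j, v ord0 j \in `[(-1 : R), 1]]
    `&` cluster (y @ \oo) !=set0.
  apply: (cK (y @ \oo) _ _).
  by exists 0%N => // k _ j /=; rewrite mxE in_itv /= -ler_norml.
have sel k : exists l, (k <= l)%N /\ forall j, `|a ord0 j - y l ord0 j| < k.+1%:R^-1.
  have [] := ca [set v | exists2 l, (k <= l)%N & v = y l] (ball a k.+1%:R^-1).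
  - by exists k => // l /= kl; exists l.
  - by apply: nbhsx_ballx; rewrite invr_gt0.
  - by move=> v [[l kl ->]] [_ /= b]; exists l; split=> // j; exact: (b ord0 j).
have [f fP] := choice sel.
exists f, (fun i => a ord0 (enum_rank i)); split=> [k|i]; first by have [] := fP k.
apply/cvgrPdist_lt => e e0.
near=> k; have [_ /(_ (enum_rank i))] := fP k.
rewrite mxE enum_rankK => /lt_trans; apply.
near: k; exact: near_infty_natSinv_lt (PosNum e0).
Unshelve. all: by end_near. Qed.

Lemma measurable_gt0 (R : realType) d (T : measurableType d) (f : T -> R) :
  measurable_fun setT f -> measurable [set x | 0 < f x].
Proof.
move=> mf; rewrite -[X in measurable X]setTI.
rewrite [X in _ `&` X](_ : _ = f @^-1` `]0, +oo[%classic); first exact: mf.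
by apply/seteqP; split => x /=; rewrite in_itv /= andbT.
Qed.

Lemma measurable_lt0 (R : realType) d (T : measurableType d) (f : T -> R) :
  measurable_fun setT f -> measurable [set x | f x < 0].
Proof.
move=> mf; rewrite (_ : mkset _ = [set x | 0 < - f x]).
  by apply: measurable_gt0; exact: measurableT_comp.
by apply/seteqP; split => x /=; rewrite oppr_gt0.
Qed.

Section hyperplane_null.
Variable R : realType.

Definition lform d (u x : 'rV[R]_d) : R := \sum_j u ord0 j * x ord0 j.

Lemma measurable_lform d (u : 'rV[R]_d) :
  measurable_fun [set: borel_rV R d]
    (fun x : borel_rV R d => lform u x : measurableTypeR R).
Proof.
apply: measurable_sum => j; apply: measurable_funM; first exact: measurable_cst.
exact: measurable_coord_rV.
Qed.

Lemma measurable_hyperplane d (v : 'rV[R]_d) c :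
  measurable (hyperplane v c : set (borel_rV R d)).
Proof.
rewrite -[X in measurable X]setTI.
exact: measurable_lform (measurable_set1 c).
Qed.

(** Fubini along the first coordinate. If the remaining part [v'] of the normal is nonzero, every
    section is null by induction; otherwise the only nonempty section lies over the single point c /
    v_0. *)
Lemma lebesgue_hyperplane d (v : 'rV[R]_d) c : v != 0 ->
  lebesgue_rV R d (hyperplane v c) = 0%E.
Proof.
elim: d v c => [|d IH] v c v0; first by move: v0; rewrite thinmx0 eqxx.
pose v' : 'rV[R]_d := \row_j v ord0 (lift ord0 j).
rewrite /= /lebesgue_step /pushforward /product_measure1.
have sec x : xsection (@cons_rV R d @^-1` hyperplane v c) x =
    hyperplane v' (c - v ord0 ord0 * x).
  apply/seteqP; split => y; rewrite /xsection /hyperplane /= ?inE /=.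
    rewrite big_ord_recl cons_rVE unlift_none /= => <-.
    rewrite addrC addKr.
    by apply: eq_bigr => j _; rewrite cons_rVE liftK /= mxE.
  move=> e; rewrite big_ord_recl cons_rVE unlift_none /=.
  rewrite -[RHS](subrK (v ord0 ord0 * x)) -e addrC; congr (_ + _).
  by apply: eq_bigr => j _; rewrite cons_rVE liftK /= mxE.
have [v'0|v'0] := eqVneq v' 0; last first.
  by apply: integral0_eq => x _ /=; rewrite sec IH.
have v00 : v ord0 ord0 != 0.
  apply: contraNneq v0 => v00; apply/eqP/rowP => j; rewrite mxE.
  have [i ->|->//] := unliftP ord0 j.
  by have /rowP/(_ i) := v'0; rewrite !mxE.
transitivity (\int[@lebesgue_measure R]_(x in [set (c / v ord0 ord0)%R])
    (lebesgue_rV R d \o xsection (@cons_rV R d @^-1` hyperplane v c)) x)%E.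
  rewrite [RHS]integral_mkcond; apply: eq_integral => x _.
  rewrite patchE; case: ifPn => // xc /=.
  rewrite sec v'0 (_ : hyperplane _ _ = set0) ?measure0//.
  apply/seteqP; split => // y; rewrite /hyperplane /= big1; last first.
    by move=> j _; rewrite mxE mul0r.
  move=> e; move: xc; rewrite notin_setE /=; apply.
  apply: (mulfI v00); rewrite mulrCA mulfV// mulr1.
  by apply/eqP; rewrite eq_sym -subr_eq0 -e.
exact: integral_set1.
Qed.
End hyperplane_null.

(** Dominated convergence: where f is nonzero the indicators of positivity are eventually constant,
    and f vanishes only on a null set. *)
Lemma cvg_measure_pos (R : realType) d (T : measurableType d)
    (mu : {finite_measure set T -> \bar R}) (f_ : nat -> T -> R) (f : T -> R) :
  (forall k, measurable_fun setT (f_ k)) -> measurable_fun setT f ->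
  (forall x, f_ ^~ x @ \oo --> f x) -> mu [set x | f x = 0] = 0%E ->
  (fun k => mu [set x | 0 < f_ k x]) @ \oo --> mu [set x | 0 < f x].
Proof.
move=> mf_ mf ff f0.
pose F k x : \bar R := (\1_[set x | 0 < f_ k x] x)%:E.
pose G x : \bar R := (\1_[set x | 0 < f x] x)%:E.
have [//|||||_ _] := @dominated_convergence _ _ _ mu setT measurableT F G (cst 1%E).
- by move=> k; apply/measurable_EFinP/measurable_indic/measurable_gt0.
- by apply/measurable_EFinP/measurable_indic/measurable_gt0.
- exists [set x | f x = 0]; split => //.
    by rewrite -[X in measurable X]setTI; exact: mf (measurable_set1 0).
  move=> x /=; apply: contra_notP => /eqP fx0 _.
  apply: cvg_near_cst; rewrite /F /G.
  have [fx|fx|fx] := ltgtP (f x) 0; last by rewrite fx eqxx in fx0.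
  + near=> k; congr EFin; rewrite !indicE !memNset//=; last first.
      apply/negP; rewrite -leNgt ltW//; near: k; exact: cvgr_lt (ff x) _ fx.
    by apply/negP; rewrite -leNgt ltW.
  + near=> k; congr EFin; rewrite !indicE !mem_set//=.
    near: k; exact: cvgr_gt (ff x) _ fx.
- exact: finite_measure_integrable_cst.
- apply: aeW => x k _ /=; rewrite lee_fin indicE.
  by case: (_ \in _); rewrite ?normr1 ?normr0.
have -> : (\int[mu]_x G x)%E = mu [set x | 0 < f x].
  by rewrite /G integral_indic ?setIT//; exact: measurable_gt0.
rewrite (_ : [sequence _]_n = fun k => mu [set x | 0 < f_ k x])//.
by apply/funext => k; rewrite /= /F integral_indic ?setIT//; exact: measurable_gt0.
Unshelve. all: by end_near. Qed.

(** * The chessboard function of a coefficient vector *)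

Section chessboard_function.
Variables (R : realType) (d t L : nat).
Implicit Types (a : 'I_t * 'I_L -> R) (v : 'I_t -> 'rV[R]_d) (x : 'rV[R]_d).

(* The last coordinates of a block are the low-order coefficients, because
   [hemi] pads with zeros on the left. *)
Definition block_poly a (i : 'I_t) : {poly R} :=
  \sum_(j < L) a (i, j) *: 'X^(L - j.+1).

Definition board v a x : R := \prod_i (block_poly a i).[lform (v i) x].

Lemma measurable_board v a :
  measurable_fun [set: borel_rV R d]
    (fun x : borel_rV R d => board v a x : measurableTypeR R).
Proof.
apply: measurable_prod => i _.
apply: (measurableT_comp
  (f := horner (block_poly a i) : measurableTypeR R -> measurableTypeR R)).
  by apply: continuous_measurable_fun; exact: continuous_horner.
exact: measurable_lform.
Qed.

Lemma cvg_board v (a_ : nat -> 'I_t * 'I_L -> R) a x :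
  (forall ij, (fun k => a_ k ij) @ \oo --> a ij) ->
  (fun k => board v (a_ k) x) @ \oo --> board v a x.
Proof.
move=> aa; rewrite /board; apply: cvg_big => //=.
  exact: mul_continuous.
move=> i _; rewrite /block_poly horner_sum.
under eq_fun do rewrite horner_sum.
apply: cvg_big => //=; first exact: add_continuous.
move=> j _; rewrite hornerZ; under eq_fun do rewrite hornerZ.
by apply: cvgMl; exact: aa.
Qed.

(** The roots, with multiplicity, become hyperplane offsets, and q only contributes a constant sign.
    As [size p] is the degree plus one, the strict inequality bounds the number of roots by the
    degree. *)
Lemma split_real_roots (p : {poly R}) : p != 0 ->
  exists (s : seq R) (q : {poly R}),
    [/\ p = (\prod_(c <- s) ('X - c%:P)) * q, forall y, q.[y] != 0 &
        (size s < size p)%N].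
Proof.
have [k] := ubnP (size p); elim: k p => // k IH p pk p0.
have [[c /factor_theorem[q pq]]|nor] := pselect (exists c, root p c); last first.
  exists [::], p; rewrite big_nil mul1r size_poly_gt0; split=> // y.
  by apply: contra_notN nor => py; exists y.
have q0 : q != 0 by apply: contraNneq p0 => q0; rewrite pq q0 mul0r.
have pS : size p = (size q).+1 by rewrite pq size_Mmonic ?monicXsubC// size_XsubC addn2.
have [|s [r [qE r0 ss]]] := IH q _ q0; first by rewrite -ltnS -pS.
by exists (c :: s), r; split=> //=; rewrite ?pS// pq qE big_cons mulrC mulrA.
Qed.

Lemma board_null (mu : probability (borel_rV R d) R) v a :
  mu `<< lebesgue_rV R d -> (forall i, v i != 0) -> (forall i, block_poly a i != 0) ->
  mu [set x | board v a x = 0] = 0%E.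
Proof.
move=> muL v0 a0.
have mz : measurable ([set x | board v a x = 0] : set (borel_rV R d)).
  by rewrite -[X in measurable X]setTI; exact: measurable_board (measurable_set1 0).
suff : lebesgue_rV R d [set x | board v a x = 0] = 0%E.
  by move/null_content_dominatesP : muL => /(_ _ mz).
have [s sP] := choice (fun i => split_real_roots (a0 i)).
apply/negligibleP => //.
pose N := \big[setU/set0]_(i < t) \big[setU/set0]_(c <- s i)
  (hyperplane (v i) c : set (borel_rV R d)).
apply: (@negligibleS _ _ _ _ N) => [x /= /eqP|].
  rewrite /board prodf_seq_eq0 => /hasP[i _ /=].
  have [q [-> q0 _]] := sP i.
  rewrite hornerM mulf_eq0 (negbTE (q0 _)) orbF horner_prod prodf_seq_eq0.
  move=> /hasP[c cs]; rewrite /= hornerXsubC subr_eq0 => /eqP e.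
  rewrite /N -bigcup_seq; exists i; first by rewrite /= mem_index_enum.
  by rewrite -bigcup_seq; exists c.
have negU : forall A B : set (borel_rV R d), (lebesgue_rV R d).-negligible A ->
    (lebesgue_rV R d).-negligible B -> (lebesgue_rV R d).-negligible (A `|` B).
  exact: negligibleU.
have neg0 : (lebesgue_rV R d).-negligible (set0 : set (borel_rV R d)).
  exact: negligible_set0.
apply: (big_ind (fun A => (lebesgue_rV R d).-negligible A)) => // i _.
apply: (big_ind (fun A => (lebesgue_rV R d).-negligible A)) => // c _.
apply/negligibleP; first exact: measurable_hyperplane.
exact: lebesgue_hyperplane.
Qed.

End chessboard_function.

(** * Existence of a halving product of polynomials *)

Section halving.
Variables (R : realType) (d t L : nat) (v : 'I_t -> 'rV[R]_d).

Definition cell_point (m : nat) (e : seq (seq int)) (ij : 'I_t * 'I_L) : R :=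
  (nth 0 (nth [::] e ij.1) ij.2)%:~R / (m.*2)%:R.

Lemma nth_map_opp (b : seq int) j : nth 0 (map -%R b) j = - nth 0 b j.
Proof.
have [jb|bj] := ltnP j (size b); first by rewrite (nth_map 0).
by rewrite !nth_default ?size_map// oppr0.
Qed.

Lemma cell_point_antipode m e (i : 'I_t) ij : size e = t ->
  cell_point m (antipode i e) ij = (-1) ^+ (ij.1 == i) * cell_point m e ij.
Proof.
move=> et; rewrite /cell_point /antipode nth_modify ?et// (_ : _ == _ = (ij.1 == i))//.
by case: eqP => _; rewrite ?nth_map_opp ?mul1r// mulN1r rmorphN mulNr.
Qed.

Lemma block_poly_antipode m e (i l : 'I_t) : size e = t ->
  block_poly (cell_point m (antipode i e)) l =
  (-1) ^+ (l == i) *: block_poly (cell_point m e) l.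
Proof.
move=> et; rewrite /block_poly scaler_sumr; apply: eq_bigr => j _.
by rewrite cell_point_antipode// scalerA.
Qed.

Lemma board_antipode m e (i : 'I_t) x : size e = t ->
  board v (cell_point m (antipode i e)) x = - board v (cell_point m e) x.
Proof.
move=> et; rewrite /board (bigD1 i)//= [in RHS](bigD1 i)//=.
rewrite block_poly_antipode// eqxx hornerZ expr1 mulN1r mulNr.
congr (- (_ * _)); apply: eq_bigr => l /negbTE li.
by rewrite block_poly_antipode// li scale1r.
Qed.

(* The sign of [orientation e] breaks the ties [imbalance = 0] equivariantly. *)
Definition orientation (e : seq (seq int)) : int :=
  \prod_(b <- e) head 0 [seq x <- b | x != 0].

Lemma orientation_antipode i e : (i < size e)%N ->
  orientation (antipode i e) = - orientation e.
Proof.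
rewrite /orientation /antipode; elim: e i => [|b e IH] [|i] //= ie.
  have fN : [seq x <- map -%R b | x != 0] = map -%R [seq x <- b | x != 0].
    by rewrite filter_map; congr map; apply: eq_filter => x /=; rewrite oppr_eq0.
  by rewrite !big_cons fN -mulNr; congr (_ * _); case: [seq _ <- _ | _].
by rewrite !big_cons IH// mulrN.
Qed.

Lemma orientation_neq0 m e : (0 < m)%N -> nondegenerate m e -> orientation e != 0.
Proof.
move=> m0 /allP en; rewrite /orientation prodf_seq_neq0; apply/allP => b be /=.
have /hasP[x xb /eqP xm] := en b be.
have : x \in [seq x <- b | x != 0] by rewrite mem_filter xb andbT; lia.
case E : [seq x <- b | x != 0] => [//|y s] _ /=.
have : y \in [seq x <- b | x != 0] by rewrite E mem_head.
by rewrite mem_filter => /andP[].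
Qed.

Definition imbalance (mu : probability (borel_rV R d) R) (a : 'I_t * 'I_L -> R) : R :=
  fine (mu [set x | 0 < board v a x]) - fine (mu [set x | board v a x < 0]).

Lemma imbalance_antipode mu m e (i : 'I_t) : size e = t ->
  imbalance mu (cell_point m (antipode i e)) = - imbalance mu (cell_point m e).
Proof.
move=> et; rewrite /imbalance opprB; congr (fine (mu _) - fine (mu _)).
  by apply/seteqP; split => x /=; rewrite board_antipode// oppr_gt0.
by apply/seteqP; split => x /=; rewrite board_antipode// oppr_lt0.
Qed.

Lemma block_poly_eq0 (a : 'I_t * 'I_L -> R) i :
  block_poly a i = 0 -> forall j, a (i, j) = 0.
Proof.
move=> a0 j; have /(congr1 (fun p : {poly R} => p`_(L - j.+1))) := a0.
rewrite coef0 /block_poly coef_sum (bigD1 j)//= coefZ coefXn eqxx mulr1.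
rewrite big1 ?addr0// => l lj; rewrite coefZ coefXn.
have /negbTE -> : (L - j.+1 != L - l.+1)%N.
  apply: contraNneq lj => e; apply/eqP/val_inj => /=.
  by have := ltn_ord l; have := ltn_ord j; lia.
by rewrite mulr0.
Qed.

Lemma size_block_poly (a : 'I_t * 'I_L -> R) i k :
  (forall j : 'I_L, (j < L - k)%N -> a (i, j) = 0) -> (size (block_poly a i) <= k)%N.
Proof.
move=> a0; apply: (leq_trans (size_sum _ _ _)); apply/bigmax_leqP => j _.
have [jk|kj] := ltnP j (L - k); first by rewrite a0// scale0r size_poly0.
apply: (leq_trans (size_scale_leq _ _)); rewrite size_polyXn.
by have := ltn_ord j; lia.
Qed.

Hypothesis v_neq0 : forall i, v i != 0.

Lemma cvg_imbalance (mu : probability (borel_rV R d) R)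
    (a_ : nat -> 'I_t * 'I_L -> R) a :
  mu `<< lebesgue_rV R d -> (forall i, block_poly a i != 0) ->
  (forall ij, (fun k => a_ k ij) @ \oo --> a ij) ->
  (fun k => imbalance mu (a_ k)) @ \oo --> imbalance mu a.
Proof.
move=> muL a0 aa.
have mb (a' : 'I_t * 'I_L -> R) := measurable_board v a'.
have mpos : measurable ([set x | 0 < board v a x] : set (borel_rV R d)).
  exact: measurable_gt0 (mb a).
have mneg : measurable ([set x | board v a x < 0] : set (borel_rV R d)).
  exact: measurable_lt0 (mb a).
apply: cvgB; apply: fine_cvg; rewrite fineK ?fin_num_measure//.
  apply: cvg_measure_pos; [by move=> k; exact: mb|exact: mb| |exact: board_null].
  by move=> x; exact: cvg_board.
rewrite (_ : [set x | board v a x < 0] = [set x | 0 < - board v a x]); last first.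
  by apply/seteqP; split => x /=; rewrite oppr_gt0.
rewrite (_ : (fun k => _) = fun k => mu [set x | 0 < - board v (a_ k) x]); last first.
  by apply/funext => k; congr (mu _); apply/seteqP; split => x /=; rewrite oppr_gt0.
apply: cvg_measure_pos.
- by move=> k; apply: measurableT_comp => //; exact: mb.
- by apply: measurableT_comp => //; exact: mb.
- by move=> x; apply: cvgN; exact: cvg_board.
- rewrite (_ : mkset _ = [set x | board v a x = 0]); first exact: board_null.
  apply/seteqP; split => x /=; first by move/eqP; rewrite oppr_eq0 => /eqP.
  by move=> ->; rewrite oppr0.
Qed.


End halving.

Lemma halving_board (R : realType) (d t : nat) (n : 'I_t -> nat)
    (v : 'I_t -> 'rV[R]_d) (mu : 'I_(\sum_i n i) -> probability (borel_rV R d) R) :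
  odd ((\sum_i n i)`! %/ \prod_i (n i)`!)%N ->
  (forall i, v i != 0) -> (forall k, mu k `<< lebesgue_rV R d) ->
  exists a : 'I_t * 'I_(\sum_i n i).+1 -> R,
    [/\ forall i, block_poly a i != 0,
        forall i, (size (block_poly a i) <= (n i).+1)%N &
        forall k, imbalance v (mu k) a = 0].
Proof.
move=> n_odd v0 muL; set N := (\sum_i n i)%N; set L := N.+1.
pose ns := [seq n i | i <- enum 'I_t].
have nst : size ns = t by rewrite size_map size_enum_ord.
have nsE (i : 'I_t) : nth 0%N ns i = n i.
  by rewrite (nth_map i) ?size_enum_ord// nth_ord_enum.
have nsN : sumn ns = N by rewrite sumnE big_map big_enum.
have nsL : all (fun k => (k < L)%N) ns.
  by apply/allP => _ /mapP[i _ ->]; rewrite ltnS /N (bigD1 i)//= leq_addr.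
have ns_odd : odd (multinomial (sumn ns) ns).
  have := multinomial_fact ns; rewrite nsN big_map big_enum /= => E.
  move: n_odd; rewrite -/N -E mulnK// prodn_gt0// => i; exact: fact_gt0.
pose F k e m := imbalance v (mu k) (@cell_point R t L m e).
(* Ties go to the orientation so that antipodes get opposite signs; an index k not below N has no
   measure and gets the orientation alone. *)
pose s m (k : nat) e : bool :=
  if insub k is Some k' then
    (0 < F k' e m) || ((F k' e m == 0) && (0 < orientation e))
  else 0 < orientation e.
have s_odd m k : (0 < m)%N -> odd_cochain m t (s m k).
  move=> m0 i e it et en.
  have o0 := orientation_neq0 m0 en.
  have oN : (0 < orientation (antipode i e)) = ~~ (0 < orientation e).
    by rewrite orientation_antipode ?et// oppr_gt0 -leNgt le_eqVlt (negbTE o0).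
  rewrite /s; case: insubP => [k' _ _|_]; last exact: oN.
  have -> : F k' (antipode i e) m = - F k' e m.
    exact: (@imbalance_antipode R d t L v (mu k') m e (Ordinal it) et).
  by rewrite oN oppr_gt0 oppr_eq0; case: ltgtP.
have /choice[e eP] : forall m, exists e,
    e \in chain m.+1 L ns /\ forall j, (j < sumn ns)%N -> exists u w,
      [/\ near_cell (sumn ns) e u, near_cell (sumn ns) e w,
        size u = t, nondegenerate m.+1 u &
        [/\ size w = t, nondegenerate m.+1 w & s m.+1 j u != s m.+1 j w]].
  move=> m.
  have [e eP eQ] := odd_sign_changes (fun k => s_odd m.+1 k isT) nst nsL ns_odd.
  by exists e.
have eC m := chain_cell nsL (eP m).1.
pose x m := @cell_point R t L m.+1 (e m).
have absZ (z : int) m : `|z%:~R / (m.+1.*2)%:R : R| = `|z|%N%:R / (m.+1.*2)%:R.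
  by rewrite normrM normfV normr_nat natr_absz intr_norm.
have dbl m : 0 < (m.+1.*2)%:R :> R by rewrite ltr0n double_gt0.
have x1 m ij : `|x m ij| <= 1.
  rewrite /x /cell_point absZ ler_pdivrMr// mul1r ler_nat.
  have [_ _ /(_ ij.1)] := eC m; rewrite nst => /(_ (ltn_ord _)) [eL eb _].
  by move/all_nthP : eb; apply; rewrite eL.
have [f [a [fk xa]]] := bounded_seq_extraction x1.
(* Each cell has a coordinate of absolute value 1 in block i, which a zero limit of that block would
   exclude. *)
have a0 i : block_poly a i != 0.
  apply/eqP => /block_poly_eq0 a0.
  have /filter_ex[k xk] : \forall k \near \oo, forall j, `|x (f k) (i, j)| < 1.
    apply: filter_forall => j.
    by apply: (cvgr_norm_lt _ (xa (i, j))); rewrite a0 normr0.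
  have [et /allP en /(_ i)] := eC (f k); rewrite nst => /(_ (ltn_ord _)) [eL _ _].
  have eiP : nth [::] (e (f k)) i \in e (f k) by rewrite mem_nth ?et ?nst.
  have /(has_nthP 0)[j] := en _ eiP; rewrite eL => jL /eqP jm.
  by have := xk (Ordinal jL); rewrite /x /cell_point absZ /= jm divff ?ltxx// gt_eqF.
exists a; split=> //.
  move=> i; apply: size_block_poly => j jL.
  have := xa (i, j); rewrite (_ : (fun k => _) = cst 0).
    by move/(cvg_lim (@Rhausdorff R)) => <-; exact: lim_cst.
  apply/funext => k; have [_ _ /(_ i)] := eC (f k).
  rewrite nst nsE => /(_ (ltn_ord _)) [_ _ /(_ j jL)] /= z.
  by rewrite /x /cell_point z mul0r.
(* Lattice distance N becomes at most N / (k + 1) after rescaling, since k <= [f k]. *)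
have near_cvg (u : nat -> seq (seq int)) : (forall m, near_cell N (e m) (u m)) ->
    forall ij, (fun k => @cell_point R t L (f k).+1 (u (f k)) ij) @ \oo --> a ij.
  move=> eu ij.
  rewrite (_ : (fun k => _) = (fun k => x (f k) ij) \+
     (fun k => @cell_point R t L (f k).+1 (u (f k)) ij - x (f k) ij)); last first.
    by apply/funext => k /=; rewrite addrC subrK.
  rewrite -[a ij]addr0; apply: cvgD => //.
  have cN : N%:R * harmonic k @[k --> \oo] --> (0 : R).
    by rewrite -(mulr0 N%:R); apply: cvgM; [exact: cvg_cst|exact: cvg_harmonic].
  apply: (@squeeze_cvgr _ _ _ _ (fun k => - (N%:R * harmonic k))
    (fun k => N%:R * harmonic k)).
  - near=> k; rewrite -ler_norml distrC /x /cell_point -mulrBl -rmorphB absZ.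
    have le1 : (`|(nth 0 (nth [::] (e (f k)) ij.1) ij.2 -
        nth 0 (nth [::] (u (f k)) ij.1) ij.2)%R| <= N)%N.
      by have := eu (f k) ij.1 ij.2; rewrite -abszE lez_nat.
    apply: ler_pM => //; rewrite ?ler_nat// ?invr_ge0 ?ler0n//.
    by rewrite /= lef_pV2 ?posrE ?ltr0n// ler_nat; have := fk k; lia.
  - by rewrite -[0]oppr0; exact: cvgN.
  - exact: cN.
move=> k.
have /choice[u uP] : forall m, exists u : seq (seq int) * seq (seq int),
    [/\ near_cell N (e m) u.1, near_cell N (e m) u.2 &
        s m.+1 k u.1 != s m.+1 k u.2].
  move=> m.
  have [_ /(_ k)] := eP m; rewrite nsN => /(_ (ltn_ord k)) [u [w [eu ew _ _ [_ _ sd]]]].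
  by exists (u, w).
have cu : (fun l => F k (u (f l)).1 (f l).+1) @ \oo --> imbalance v (mu k) a.
  apply: cvg_imbalance => //; apply: (near_cvg (fun m => (u m).1)) => m.
  by have [] := uP m.
have cw : (fun l => F k (u (f l)).2 (f l).+1) @ \oo --> imbalance v (mu k) a.
  apply: cvg_imbalance => //; apply: (near_cvg (fun m => (u m).2)) => m.
  by have [] := uP m.
have cuw := cvgM cu cw _.
(* The imbalances at the two cells have product at most 0, ties included, while this product tends
   to the square of the limit. *)
apply/eqP; rewrite -sqrf_eq0 eq_le sqr_ge0 andbT expr2 -(cvg_lim (@Rhausdorff R) (cuw _)).
apply: limr_le.
  by apply/cvg_ex; exists (imbalance v (mu k) a * imbalance v (mu k) a); exact: cuw.
near=> l; have [_ _] := uP (f l); rewrite /s valK /=.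
set p := F _ (u _).1 _; set q := F _ (u _).2 _.
case: (ltgtP p 0) => [p0|p0|->]; case: (ltgtP q 0) => [q0|q0|->] //= _;
  rewrite ?mulr0 ?mul0r//.
- by rewrite ltW// nmulr_rlt0.
- by rewrite ltW// pmulr_rlt0.
Unshelve. all: by end_near. Qed.

(** * From polynomials to hyperplane arrangements *)

Section linear_form.
Variables (R : realType) (d : nat).
Implicit Types (u w x : 'rV[R]_d).

Lemma lformD u x y : lform u (x + y) = lform u x + lform u y.
Proof. by rewrite -big_split; apply: eq_bigr => j _; rewrite mxE mulrDr. Qed.

Lemma lformZ u k x : lform u (k *: x) = k * lform u x.
Proof. by rewrite mulr_sumr; apply: eq_bigr => j _; rewrite mxE mulrCA. Qed.

Lemma lformZl u k x : lform (k *: u) x = k * lform u x.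
Proof. by rewrite mulr_sumr; apply: eq_bigr => j _; rewrite mxE mulrA. Qed.

Lemma lformB u x y : lform u (x - y) = lform u x - lform u y.
Proof. by rewrite lformD -scaleN1r lformZ mulN1r. Qed.

Lemma lform_self_gt0 u : u != 0 -> 0 < lform u u.
Proof.
move=> u0; rewrite lt_def sumr_ge0 ?andbT; last first.
  by move=> j _; rewrite -expr2 sqr_ge0.
apply: contraNneq u0 => /eqP; rewrite psumr_eq0; last first.
  by move=> j _; rewrite -expr2 sqr_ge0.
move/allP => uj; apply/eqP/rowP => j; rewrite mxE.
by have := uj j (mem_index_enum _); rewrite /= mulf_eq0 orbb => /eqP.
Qed.

Lemma continuous_lform u : continuous (lform u).
Proof.
move=> x; apply: (cvg_big _ (nbhs_filter x)); first exact: add_continuous.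
move=> j _; apply: (@continuousM _ _ (fun=> u ord0 j) (fun y : 'rV[R]_d => y ord0 j)).
  exact: cst_continuous.
exact: coord_continuous.
Qed.

(** Directions may be parallel, so one hyperplane can be listed twice. Adding to the foot point [x0]
    the component of x orthogonal to u stays in the hyperplane; hence [lform w] vanishes on the
    orthogonal complement of u and is a multiple of [lform u]. *)
Lemma hyperplane_eq u w c e : u != 0 -> w != 0 -> hyperplane u c = hyperplane w e ->
  exists2 k, k != 0 & forall x, lform w x - e = k * (lform u x - c).
Proof.
move=> u0 w0 /seteqP[uw _].
have uu : lform u u != 0 by rewrite gt_eqF// lform_self_gt0.
have ww : lform w w != 0 by rewrite gt_eqF// lform_self_gt0.
pose x0 := (c / lform u u) *: u.
have ux0 : lform u x0 = c by rewrite lformZ divfK.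
have wx0 : lform w x0 = e by exact: (uw x0 ux0).
have wE x : lform w x = lform w u / lform u u * lform u x.
  have ux : lform u (x0 + (x - (lform u x / lform u u) *: u)) = c.
    by rewrite lformD ux0 lformB lformZ divfK// subrr addr0.
  have wx : lform w (x0 + (x - (lform u x / lform u u) *: u)) = e by exact: (uw _ ux).
  move/eqP: wx; rewrite lformD wx0 -subr_eq0 addrAC subrr add0r lformB lformZ.
  by rewrite subr_eq0 => /eqP ->; rewrite mulrC mulrA [RHS]mulrAC.
exists (lform w u / lform u u).
  by apply: contraNneq ww => k0; rewrite wE k0 mul0r.
by move=> x; rewrite mulrBr -wE -wx0 -ux0 -wE.
Qed.

End linear_form.

Lemma horner_sg_cst (R : rcfType) (q : {poly R}) : (forall y, q.[y] != 0) ->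
  forall y z, Num.sg q.[y] = Num.sg q.[z].
Proof.
move=> q0 y z; wlog yz : y z / y <= z.
  by move=> H; have [/H//|/ltW/H ->] := leP y z.
wlog qy : q q0 / 0 < q.[y].
  move=> H; have [|qy|qy] := ltgtP q.[y] 0; last by have := q0 y; rewrite qy eqxx.
    rewrite -oppr_gt0 -hornerN => /H; rewrite !hornerN !sgrN => E.
    by apply: oppr_inj; apply: E => x; rewrite hornerN oppr_eq0.
  exact: H.
rewrite gtr0_sg// gtr0_sg// ltNge; apply/negP => qz.
have [|x _] := @poly_ivt _ (- q) y z yz.
  by rewrite !hornerN oppr_le0 oppr_ge0 qz ltW.
by rewrite rootN; apply/negP; exact: q0.
Qed.

(** * Regions, facets and colourings of an arrangement *)

Section chessboard.
Variables (R : realType) (d t : nat) (v : 'I_t -> 'rV[R]_d).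
Hypothesis v_neq0 : forall i, v i != 0.
Implicit Types (l : seq ('I_t * R)) (p : 'I_t * R) (x : 'rV[R]_d).

Definition offset p x : R := lform (v p.1) x - p.2.

Definition offset_prod l x : R := \prod_(p <- l) offset p x.

Lemma board_offset_prod L (a : 'I_t * 'I_L -> R) (n : 'I_t -> nat) :
  (forall i, block_poly a i != 0) ->
  (forall i, (size (block_poly a i) <= (n i).+1)%N) ->
  exists l, (forall i, (count (fun p => p.1 == i) l <= n i)%N) /\
    exists2 k, k != 0 & forall x, Num.sg (board v a x) = k * Num.sg (offset_prod l x).
Proof.
move=> a0 an; have [s sP] := choice (fun i => split_real_roots (a0 i)).
pose l := [seq (i, c) | i <- enum 'I_t, c <- s i].
exists l; split=> [i|].
  have [q [_ _ si]] := sP i; apply: (@leq_trans (size (s i))).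
    rewrite count_flatten sumnE big_map big_map big_enum (bigD1 i)//= big1 ?addn0.
      by rewrite count_map (leq_trans (count_size _ _)).
    move=> j ji; rewrite count_map; apply/eqP; rewrite -leqn0 leqNgt -has_count.
    by apply/hasP => -[c _ /= /eqP e]; rewrite e eqxx in ji.
  by rewrite -ltnS (leq_trans si).
have [q qP] := choice sP.
(* The rootless cofactors have constant sign, so their signs may be read off at 0. *)
exists (\prod_i Num.sg (q i).[0]).
  by apply/prodf_neq0 => i _; have [_ q0 _] := qP i; rewrite sgr_eq0.
move=> x; rewrite /board /offset_prod big_allpairs_dep big_enum /=.
rewrite -[in RHS](big_morph Num.sg (@sgrM R) (@sgr1 R)).
rewrite -sgrM -big_split !(big_morph Num.sg (@sgrM R) (@sgr1 R)).
apply: eq_bigr => i _; have [pE q0 _] := qP i.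
rewrite pE hornerM horner_prod !sgrM mulrC; congr (_ * _).
  exact: horner_sg_cst.
by congr Num.sg; apply: eq_bigr => c _; rewrite hornerXsubC.
Qed.

Definition distinct_hyperplanes l : Prop :=
  uniq l /\ {in l &, forall p q,
    hyperplane (v p.1) p.2 = hyperplane (v q.1) q.2 -> p = q}.

(* Crossing two coinciding hyperplanes does not change the colour, whereas an
   arrangement contains each hyperplane once: they are removed in pairs. *)
Lemma cancel_hyperplanes l : exists l',
  [/\ forall i, (count (fun p => p.1 == i) l' <= count (fun p => p.1 == i) l)%N,
      distinct_hyperplanes l' &
      exists2 k, k != 0 & forall x, offset_prod l x != 0 ->
        Num.sg (offset_prod l x) = k * Num.sg (offset_prod l' x)].
Proof.
elim: l => [|p l [l' [lc [lu li] [k k0 lk]]]].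
  exists [::]; split=> //; exists 1; first exact: oner_neq0.
  by move=> x _; rewrite mul1r.
have [[q ql pq]|npq] := pselect (exists2 q, q \in l' &
    hyperplane (v p.1) p.2 = hyperplane (v q.1) q.2).
  have [c c0 cE] := hyperplane_eq (v_neq0 _) (v_neq0 _) pq.
  exists (rem q l'); split.
  - move=> i; rewrite /= (leq_trans (leq_count_subseq _ (rem_subseq _ _)))//.
    by rewrite (leq_trans (lc i)) ?leq_addl.
  - split; first exact: rem_uniq.
    by move=> a b /mem_rem al /mem_rem bl; exact: li.
  (* Since [offset q] is c times [offset p], their signs multiply to the sign of c wherever they are
     nonzero. *)
  exists (k * Num.sg c); first by rewrite mulf_neq0 ?sgr_eq0.
  move=> x; rewrite /offset_prod big_cons -/(offset_prod _ _) mulf_eq0 negb_or.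
  move=> /andP[px lx]; rewrite sgrM lk//.
  rewrite /offset_prod (perm_big _ (perm_to_rem ql)) big_cons -/(offset_prod _ _).
  have -> : offset q x = c * offset p x by exact: cE.
  rewrite !sgrM; have e : Num.sg (offset p x) * Num.sg (offset p x) = 1.
    by rewrite -expr2 sqr_sg px.
  transitivity (k * Num.sg c * Num.sg (offset_prod (rem q l') x) *
    (Num.sg (offset p x) * Num.sg (offset p x))); first by ring.
  by rewrite e mulr1.
exists (p :: l'); split.
- by move=> i; rewrite /= leq_add2l.
- split; first by rewrite /= lu andbT; apply/negP => pl; apply: npq; exists p.
  move=> a b; rewrite !inE => /predU1P[->|al] /predU1P[->|bl] //; last exact: li.
    by move=> ab; case: npq; exists b.
  by move=> ab; case: npq; exists a.
- exists k => // x; rewrite /offset_prod !big_cons -!/(offset_prod _ _).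
  by rewrite mulf_eq0 negb_or => /andP[px lx]; rewrite !sgrM lk// mulrCA.
Qed.

Variable l : seq ('I_t * R).
Hypothesis l_distinct : distinct_hyperplanes l.

Definition offsets (i : 'I_t) : seq R := [seq p.2 | p <- l & p.1 == i].

Let H := arrangement v offsets.

Lemma arrangementC x : (~` H) x <-> forall p, p \in l -> offset p x != 0.
Proof.
split=> [Hx p pl|lx [i _ [c /=]]].
  apply/eqP => px; apply: Hx; exists p.1 => //; exists p.2 => /=.
    by apply/mapP; exists p => //; rewrite mem_filter eqxx.
  by apply/eqP; rewrite -subr_eq0; apply/eqP.
case/mapP => p; rewrite mem_filter => /andP[/eqP <- pl] -> /= e.
by have := lx p pl; rewrite /offset -/(lform _ _) /lform e subrr eqxx.
Qed.

Lemma continuous_offset p : continuous (offset p).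
Proof.
move=> x; apply: (@continuousB _ _ _ (lform (v p.1)) (fun=> p.2)).
  exact: continuous_lform.
exact: cst_continuous.
Qed.

(** A region is connected and avoids the zeros of [offset p], so its image is an interval without
    0. *)
Lemma region_sg x y p : p \in l -> (~` H) x -> connected_component (~` H) x y ->
  Num.sg (offset p y) = Num.sg (offset p x).
Proof.
move=> pl Hx xy.
have Cx : connected_component (~` H) x x by exact: connected_component_refl.
have := connected_continuous_connected (@component_connected _ (~` H) x)
  (continuous_subspaceT (@continuous_offset p)).
move/connected_intervalP => itv.
have nz : ~ (offset p @` connected_component (~` H) x) 0.
  move=> [z zC z0]; have /arrangementC/(_ p pl) := connected_component_sub zC.
  by rewrite z0 eqxx.
have ix : (offset p @` connected_component (~` H) x) (offset p x) by exists x.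
have iy : (offset p @` connected_component (~` H) x) (offset p y) by exists y.
have [x0|x0|x0] := ltgtP (offset p x) 0; have [y0|y0|y0] := ltgtP (offset p y) 0;
  rewrite ?(ltr0_sg x0) ?(gtr0_sg x0) ?(ltr0_sg y0) ?(gtr0_sg y0)//;
  exfalso; apply: nz.
- by apply: itv ix iy _ _; rewrite !ltW.
- by rewrite -y0.
- by apply: itv iy ix _ _; rewrite !ltW.
- by rewrite -y0.
- by rewrite -x0.
- by rewrite -x0.
- by rewrite -x0.
Qed.

(** Converse of [region_sg]: the segment from x to y meets no hyperplane, because each offset is
    affine and has the same sign at both ends. *)
Lemma same_region x y : (~` H) x ->
  (forall p, p \in l -> Num.sg (offset p y) = Num.sg (offset p x)) ->
  connected_component (~` H) x = connected_component (~` H) y.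
Proof.
move=> Hx xy; apply: same_connected_component.
pose g (s : R) := x + s *: (y - x).
have cg : continuous g.
  move=> s; apply: (@continuousD _ _ _ (fun=> x) (fun s : R => s *: (y - x))).
    exact: cst_continuous.
  exact: scalel_continuous.
have gC : connected (g @` `[0, 1]).
  apply: connected_continuous_connected; last exact: continuous_subspaceT.
  exact: segment_connected.
apply: (connected_component_max _ _ gC).
- by exists 0; rewrite /= ?in_itv /= ?lexx ?ler01// /g scale0r addr0.
- move=> _ [s /= + <-]; rewrite in_itv /= => /andP[s0 s1].
  apply/arrangementC => p pl; have px := (arrangementC x).1 Hx p pl.
  have -> : offset p (g s) = (1 - s) * offset p x + s * offset p y.
    rewrite /offset /g lformD lformZ lformB; ring.
  have := xy p pl.
  have [x0|x0|x0] := ltgtP (offset p x) 0; last by rewrite x0 eqxx in px.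
  + rewrite (ltr0_sg x0) => /eqP; rewrite sgr_cp0 => y0; apply/eqP; nra.
  + rewrite (gtr0_sg x0) => /eqP; rewrite sgr_cp0 => y0; apply/eqP; nra.
- by exists 1; rewrite /= ?in_itv /= ?lexx ?ler01// /g scale1r addrC subrK.
Qed.

Lemma closure_ge0 (g : 'rV[R]_d -> R) P : continuous g ->
  (forall z, P z -> 0 <= g z) -> forall z, closure P z -> 0 <= g z.
Proof.
move=> cg Pg; have cl : closed (g @^-1` [set s | 0 <= s]).
  by apply: closed_comp => [z _|]; [exact: cg|exact: closed_ge].
move=> z Pz; have : closure (g @^-1` [set s | 0 <= s]) z by exact: closureS Pz.
by move/closure_id : cl => <-.
Qed.

(** On the closure of a region [offset p] keeps weakly the sign it has on the region; two opposite
    weak signs force 0. *)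
Lemma facet_offset0 x y p z : (~` H) x -> (~` H) y -> p \in l ->
  Num.sg (offset p x) != Num.sg (offset p y) ->
  closure (connected_component (~` H) x) z -> closure (connected_component (~` H) y) z ->
  offset p z = 0.
Proof.
move=> Hx Hy pl sxy.
have sg_ge0 w : (~` H) w -> forall u, closure (connected_component (~` H) w) u ->
    0 <= Num.sg (offset p w) * offset p u.
  move=> Hw; apply: closure_ge0 => [u|u wu].
    apply: (@continuousM _ _ (fun=> Num.sg (offset p w)) (offset p)).
      exact: cst_continuous.
    exact: continuous_offset.
  by rewrite -(region_sg pl Hw wu) -normrEsg.
move=> /(sg_ge0 _ Hx) + /(sg_ge0 _ Hy); move: sxy.
have := (arrangementC x).1 Hx p pl; have := (arrangementC y).1 Hy p pl.
have [y0|y0|->] := ltgtP (offset p y) 0; last by rewrite ?eqxx.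
  have [x0|x0|->] := ltgtP (offset p x) 0; last by rewrite ?eqxx.
    by rewrite !ltr0_sg// eqxx.
  by rewrite (ltr0_sg y0) (gtr0_sg x0) => _ _ _ zx zy; lra.
have [x0|x0|->] := ltgtP (offset p x) 0; last by rewrite ?eqxx.
  by rewrite (gtr0_sg y0) (ltr0_sg x0) => _ _ _ zx zy; lra.
by rewrite !gtr0_sg// eqxx.
Qed.

Lemma facet_unique p q (S : set 'rV[R]_d) : p \in l -> q \in l ->
  (forall z, S z -> offset p z = 0) -> (forall z, S z -> offset q z = 0) ->
  affine_dim_ge S d.-1 -> p = q.
Proof.
move=> pl ql Sp Sq [z [w [Sz Sw rk]]]; apply: l_distinct.2 => //.
have [/sub_rVP[k qE]|npq] := boolP (v q.1 <= v p.1)%MS.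
  have k0 : k != 0 by apply: contra_neq (v_neq0 q.1) => k0; rewrite qE k0 scale0r.
  have qp u : offset q u = k * (offset p u).
    have := Sp z Sz; have := Sq z Sz.
    rewrite /offset qE !lformZl => /subr0_eq <- /subr0_eq <-.
    by rewrite mulrBr.
  apply/seteqP; split=> u; rewrite /hyperplane /= -!/(lform _ _) => /eqP;
    rewrite -subr_eq0 -/(offset _ _) => e; apply/eqP; rewrite -subr_eq0 -/(offset _ _).
    by rewrite qp (eqP e) mulr0.
  by move: e; rewrite qp mulf_eq0 (negbTE k0).
have lf0 r : r \in [:: p; q] -> (\matrix_i (row i w - z)) *m (v r.1)^T = 0.
  move=> rpq; apply/matrixP => i j; rewrite !mxE.
  have rS u : S u -> offset r u = 0.
    by move: rpq; rewrite !inE => /orP[] /eqP ->; [exact: Sp|exact: Sq].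
  transitivity (lform (v r.1) (row i w - z)).
    by apply: eq_bigr => c _; rewrite !mxE ord1 mulrC.
  have := rS _ (Sw i); have := rS _ Sz.
  rewrite /offset lformB => /subr0_eq -> /subr0_eq ->.
  by rewrite subrr.
(* Differences of points of S are orthogonal to both normals: rank d - 1 on one side and at least 2
   on the other exceed d in total. *)
have := mulmx0_rank_max (A := \matrix_i (row i w - z))
  (B := (col_mx (v p.1) (v q.1))^T).
rewrite tr_col_mx mul_mx_row !lf0 ?inE ?eqxx ?orbT// row_mx0 => /(_ erefl).
rewrite rk -tr_col_mx mxrank_tr -addsmxE.
have : (\rank (v p.1) < \rank (v p.1 + v q.1)%MS)%N.
  apply: rank_ltmx; rewrite /ltmx addsmxSl /=; apply: contra npq.
  exact/submx_trans/addsmxSr.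
have := rank_leq_col (v p.1).
by rewrite rank_rV v_neq0; lia.
Qed.

Definition positive_side : set 'rV[R]_d := [set x | 0 < offset_prod l x].

Lemma offset_prod_neq0 x : (~` H) x -> offset_prod l x != 0.
Proof.
by move=> /arrangementC lx; rewrite prodf_seq_neq0; apply/allP => p /lx.
Qed.

Lemma region_sg_prod x y : (~` H) x -> connected_component (~` H) x y ->
  Num.sg (offset_prod l y) = Num.sg (offset_prod l x).
Proof.
move=> Hx xy; rewrite /offset_prod !(big_morph Num.sg (@sgrM R) (@sgr1 R)).
by apply: eq_big_seq => p pl; exact: region_sg.
Qed.

Lemma region_positive x : (~` H) x -> 0 < offset_prod l x ->
  connected_component (~` H) x `<=` positive_side.
Proof.
move=> Hx x0 y xy; have := region_sg_prod Hx xy.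
by rewrite (gtr0_sg x0) => /eqP; rewrite sgr_cp0.
Qed.

Lemma region_negative x : (~` H) x -> offset_prod l x < 0 ->
  connected_component (~` H) x `<=` ~` positive_side.
Proof.
move=> Hx x0 y xy; have := region_sg_prod Hx xy.
rewrite (ltr0_sg x0) => /eqP; rewrite sgr_cp0 => y0.
by rewrite /positive_side /=; apply/negP; rewrite -leNgt ltW.
Qed.

(** Some hyperplane separates two distinct regions, and only one when they share a facet, by
    [facet_unique]. As the list repeats no hyperplane, exactly one factor of the product changes
    sign. *)
Lemma positive_side_chessboard :
  chessboard_colouring_of H positive_side (~` positive_side).
Proof.
split; [exact: setUv|exact: setICr| |].
  move=> _ [x Hx ->]; have := offset_prod_neq0 Hx.
  have [x0|x0|//] := ltgtP (offset_prod l x) 0.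
    by right; exact: region_negative.
  by left; exact: region_positive.
move=> _ _ [x Hx ->] [y Hy ->] [PQ [dimPQ _]].
have [p pl sp] : exists2 p, p \in l & Num.sg (offset p x) != Num.sg (offset p y).
  apply: contrapT => nop; apply: PQ; apply: same_region => // p pl.
  by apply/eqP; apply: contraT => sp; case: nop; exists p => //; rewrite eq_sym.
have sq q : q \in l -> q != p -> Num.sg (offset q x) = Num.sg (offset q y).
  move=> ql; apply: contraNeq => sq; apply/eqP.
  apply: (facet_unique ql pl _ _ dimPQ) => z [zx zy].
    exact: facet_offset0 Hx Hy ql sq zx zy.
  exact: facet_offset0 Hx Hy pl sp zx zy.
have sxy : Num.sg (offset_prod l x) = - Num.sg (offset_prod l y).
  rewrite /offset_prod !(big_morph Num.sg (@sgrM R) (@sgr1 R)).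
  rewrite (bigD1_seq p)//= ?l_distinct.1// [in RHS](bigD1_seq p)//= ?l_distinct.1//.
  rewrite -mulNr; congr (_ * _).
    have := (arrangementC x).1 Hx p pl; have := (arrangementC y).1 Hy p pl.
    move: sp; have [y0|y0|//] := ltgtP (offset p y) 0.
      have [x0|x0|//] := ltgtP (offset p x) 0; first by rewrite !ltr0_sg// eqxx.
      by rewrite (ltr0_sg y0) (gtr0_sg x0) opprK.
    have [x0|x0|//] := ltgtP (offset p x) 0; last by rewrite !gtr0_sg// eqxx.
    by rewrite (gtr0_sg y0) (ltr0_sg x0).
  rewrite big_seq_cond [in RHS]big_seq_cond; apply: eq_bigr => q /andP[ql qp].
  exact: sq.
have := offset_prod_neq0 Hx.
have [x0|x0|//] := ltgtP (offset_prod l x) 0.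
  right; split; first exact: region_negative.
  apply: region_positive => //; move: sxy; rewrite (ltr0_sg x0) => /oppr_inj/esym/eqP.
  by rewrite sgr_cp0.
left; split; first exact: region_positive.
apply: region_negative => //; move: sxy; rewrite (gtr0_sg x0) => /esym/eqP.
by rewrite eqr_oppLR sgr_cp0.
Qed.

End chessboard.

(** * Measures of the two colour classes *)

Lemma measurable_offset_prod (R : realType) (d t : nat) (v : 'I_t -> 'rV[R]_d) l :
  measurable_fun [set: borel_rV R d]
    (fun x : borel_rV R d => offset_prod v l x : measurableTypeR R).
Proof.
apply: measurable_prod => p _; apply: measurable_funB.
  exact: measurable_lform.
exact: measurable_cst.
Qed.

Lemma measurable_positive_side (R : realType) (d t : nat) (v : 'I_t -> 'rV[R]_d) l :
  measurable (positive_side v l : set (borel_rV R d)).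
Proof. exact: measurable_gt0 (measurable_offset_prod v l). Qed.

(** Off the null zero set of [board], its positive and negative sets are complementary and of equal
    measure, so each has measure 1/2; the sign of k tells which of them is the positive side of
    l. *)
Lemma measure_positive_side (R : realType) (d t L : nat) (v : 'I_t -> 'rV[R]_d)
    (P : probability (borel_rV R d) R) (a : 'I_t * 'I_L -> R) l k :
  P [set x | board v a x = 0] = 0%E -> imbalance v P a = 0 ->
  k != 0 -> (forall x, board v a x != 0 ->
    Num.sg (board v a x) = k * Num.sg (offset_prod v l x)) ->
  P (positive_side v l) = (2^-1)%:E.
Proof.
move=> Z0 imb0 k0 kE.
have mb := measurable_board v a.
pose Z : set (borel_rV R d) := [set x | board v a x = 0].
pose Bp : set (borel_rV R d) := [set x | 0 < board v a x].
pose Bn : set (borel_rV R d) := [set x | board v a x < 0].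
have mZ : measurable Z.
  by rewrite -[X in measurable X]setTI; exact: mb (measurable_set1 0).
have mBp : measurable Bp by exact: measurable_gt0 mb.
have mBn : measurable Bn by exact: measurable_lt0 mb.
have drop (S : set (borel_rV R d)) : measurable S -> P S = P (S `\` Z).
  move=> mS; rewrite [LHS](measureDI P mS mZ) [X in (_ + X)%E](_ : _ = 0%E) ?adde0//.
  by apply: (subset_measure0 _ mZ) => //; exact: measurableI.
have nBp : P (~` Bp) = P Bn.
  rewrite (drop _ (measurableC mBp)); congr (P _); apply/seteqP; split => x.
    by move=> [/negP]; rewrite -leNgt le_eqVlt => /orP[/eqP|].
  move=> x0; split; first by apply/negP; rewrite -leNgt ltW.
  by move=> z; move: x0; rewrite /Bn /= z ltxx.
have eqB : P Bp = P Bn.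
  move/eqP: imb0; rewrite subr_eq0 => /eqP e.
  by rewrite -[LHS]fineK ?fin_num_measure// -[RHS]fineK ?fin_num_measure// e.
have PBp : P Bp = (2^-1)%:E.
  move: nBp; rewrite probability_setC// -eqB -(fineK (fin_num_measure P _ mBp)) -EFinB.
  by move=> [e]; congr EFin; lra.
have sgn0 x : board v a x != 0 -> offset_prod v l x != 0.
  move=> x0; have := kE x x0; apply: contra_eqN => /eqP ->.
  by rewrite sgr0 mulr0 sgr_eq0.
have mA := measurable_positive_side v l.
rewrite (drop _ mA) -PBp.
have [kn|kp] : k < 0 \/ 0 < k by case: ltgtP k0; auto.
  rewrite eqB; congr (P _); apply/seteqP; split => x.
    move=> [xl /eqP x0]; have := kE x x0; rewrite (gtr0_sg xl) mulr1 => e.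
    by rewrite /Bn /= -sgr_lt0 e.
  move=> xn; have x0 : board v a x != 0 by rewrite lt_eqF.
  split; last by apply/eqP.
  have := kE x x0; rewrite (ltr0_sg xn) /positive_side /= => e.
  by rewrite -sgr_gt0 -(nmulr_rlt0 _ kn) -e ltrN10.
congr (P _); apply/seteqP; split => x.
  move=> [xl /eqP x0]; have := kE x x0; rewrite (gtr0_sg xl) mulr1 => e.
  by rewrite /Bp /= -sgr_gt0 e.
move=> xp; have x0 : board v a x != 0 by rewrite gt_eqF.
split; last by apply/eqP.
have := kE x x0; rewrite (gtr0_sg xp) /positive_side /= => e.
by rewrite -sgr_gt0 -(pmulr_rgt0 _ kp) -e ltr01.
Qed.

Theorem theorem5p2 (R : realType) (t : nat) (n : 'I_t -> nat)
    (n_gt0 : forall i, (0 < n i)%N)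
    (n_odd : odd ((\sum_i n i)`! %/ \prod_i (n i)`!)%N)
    (d : nat) (d_gt0 : (0 < d)%N)
    (v : 'I_t -> 'rV[R]_d) (v_neq0 : forall i, v i != 0)
    (mu : 'I_(\sum_i n i) -> probability (borel_rV R d) R)
    (mu_ac : forall k, mu k `<< lebesgue_rV R d) :
  exists A B : set (borel_rV R d),
    [/\ chessboard_colouring n v A B, measurable A, measurable B &
        forall k, mu k A = (2^-1)%:E /\ mu k B = (2^-1)%:E].
Proof.
(* Successively: polynomials that balance all measures, their root hyperplanes with multiplicity,
   and the hyperplanes left after cancellation in pairs. *)
have [a [a0 an imb0]] := halving_board n_odd v_neq0 mu_ac.
have [l0 [l0n [k0 k0_neq0 l0E]]] := board_offset_prod v a0 an.
have [l [ll0 l_distinct [k k_neq0 lE]]] := cancel_hyperplanes v_neq0 l0.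
have mA := measurable_positive_side v l.
exists (positive_side v l), (~` positive_side v l); split=> //.
- exists (offsets l); split; last exact: positive_side_chessboard.
  by move=> i; rewrite size_map size_filter (leq_trans (ll0 i)).
- exact: measurableC.
- move=> j; have half : mu j (positive_side v l) = (2^-1)%:E.
    apply: (measure_positive_side (k := k0 * k) _ (imb0 j)).
    + exact: board_null.
    + by rewrite mulf_neq0.
    + move=> x x0; rewrite l0E lE ?mulrA//.
      (* The cancellation is valid off the zeros of the full product, and these are zeros of
         [board]. *)
      by apply: contraNneq x0 => x0; rewrite -sgr_eq0 l0E x0 sgr0 mulr0.
  by split=> //; rewrite probability_setC// half -EFinB; congr EFin; lra.
Qed.
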